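(* Let $r\in\mathbb{N}_0\cup\{\infty\}$. If $r\ge1$, let $X$ be a $C^r$-manifold modelled on a (possibly infinite-dimensional) locally convex space; if $r=0$, let $X$ be any Hausdorff topological space. Let $E$ and $F$ be locally convex spaces, $K$ a compact subset of $X$, $k\in\mathbb{N}_0\cup\{\infty\}$, and $f:X\times E\to F$ a mapping such that (a) $f$ is partially $C^k$ in the second argument; and (b) the functions $d_2^jf:X\times E^{2^j}\to F$ are of class $C^r$, for every $j\in\mathbb{N}_0$ with $j\le k$. Then $$f_*:\ C^r(X,E)\to C^r(X,F),\qquad\gamma\mapsto f\circ(\mathrm{id}_X,\gamma)$$ is a mapping of class $C^k$.
   Context: Locally convex spaces are real or complex and Hausdorff; manifolds are Hausdorff. Differentiability is always over $\mathbb{R}$: for locally convex spaces $E,F$ and $U\subseteq E$ open, $f:U\to F$ is $C^0$ if continuous ($d^0f:=f$); $C^1$ if it is continuous, $df(x,h):=\lim_{t\to0}t^{-1}(f(x+th)-f(x))$ exists for all $(x,h)\in U\times E$, and $df:U\times E\to F$ is continuous; recursively, for $k\ge2$, $C^k$ if it is $C^{k-1}$ and $d^{k-1}f:U\times E^{2^{k-1}-1}\to F$ is $C^1$, and then $d^kf:=d(d^{k-1}f):U\times E^{2^k-1}\to F$; and $C^\infty$ if $C^k$ for all $k$. $C^r$-manifolds are defined by charts with $C^r$ transition maps; continuous maps are also called $C^0$-maps. A map $f:X\times E\to F$ is partially $C^k$ in the second argument if $f(x,\cdot):E\to F$ is $C^k$ for each $x\in X$ and the maps $d_2^jf:X\times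 E^{2^j}\to F$, $d_2^jf(x,\cdot):=d^j(f(x,\cdot))$, are continuous for all $j\in\mathbb{N}_0$ with $j\le k$. $C^r(X,E)$ is the space of $C^r$-maps $X\to E$. Put $T^0X:=X$, $d^0\gamma:=\gamma$, and (if $r\ge1$) $d\gamma:=\mathrm{pr}_2\circ T\gamma:TX\to E$, $d^n\gamma:=d(d^{n-1}\gamma):T^nX\to E$. $C^r(X,E)$ carries the initial topology with respect to the maps $\gamma\mapsto d^n\gamma\in C(T^nX,E)$ ($n\in\mathbb{N}_0$, $n\le r$), the targets having the compact-open topology. *)

(* Defs.v *)
From HB Require Import structures.
From mathcomp Require Import all_boot all_order all_algebra.
From mathcomp Require Import complex.
From mathcomp Require Import all_classical all_reals all_analysis.

Set Implicit Arguments.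
Unset Strict Implicit.
Unset Printing Implicit Defensive.

Import Order.TTheory GRing.Theory Num.Theory.
Import numFieldTopology.Exports.

Local Open Scope classical_set_scope.
Local Open Scope ring_scope.
Local Open Scope complex_scope.

(* The product of two [preTopologicalLmodType]s is again one. *)
HB.saturate prod.

(** [None] stands for infinity. *)
Definition natinf := option nat.

Definition le_natinf (n : nat) (r : natinf) : bool :=
  if r is Some m then (n <= m)%N else true.

HB.mixin Record isHausdorff T & Topological T := {
  hausdorff_subproof : hausdorff_space T
}.

(** Mathcomp-analysis' [tvsType] is locally convex but not necessarily Hausdorff. *)
#[short(type="lcsType")]
HB.structure Definition LocallyConvex (R : numDomainType) :=
  {E of Tvs R E & isHausdorff E}.

(** A complex locally convex space regarded as a real one.  Differentiability is
    always over the reals, so it only sees the underlying real space. *)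
Definition realification (R : realType) (E : Type) : Type := E.

Section Realification.
Variables (R : realType) (E : lcsType R[i]).
Notation ER := (realification R E).

HB.instance Definition _ := GRing.Zmodule.on ER.
HB.instance Definition _ := Uniform.on ER.

Definition rscale (a : R) (x : ER) : ER := a%:C *: (x : E).

Let rscaleA a b x : rscale a (rscale b x) = rscale (a * b) x.
Proof. by rewrite /rscale scalerA rmorphM. Qed.
Let rscale1 : left_id 1 rscale.
Proof. by move=> x; rewrite /rscale rmorph1 scale1r. Qed.
Let rscaleDr : right_distributive rscale +%R.
Proof. by move=> a x y; rewrite /rscale scalerDr. Qed.
Let rscaleDl x : {morph rscale^~ x : a b / a + b}.
Proof. by move=> a b; rewrite /rscale rmorphD scalerDl. Qed.

HB.instance Definition _ :=
  GRing.Zmodule_isLmodule.Build R ER rscaleA rscale1 rscaleDr rscaleDl.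

Let radd : continuous (fun x : ER * ER => x.1 + x.2).
Proof. exact: (@add_continuous E). Qed.


Let real_complex_continuous : continuous (fun a : R => (a%:C : R[i]^o)).
Proof.
move=> a; apply/cvg_ballP => e e0.
have eE : e = (complex.Re e)%:C.
  by case: e e0 => x y; rewrite ltcE /= => /andP[/eqP-> _].
have re0 : 0 < complex.Re e by rewrite eE ltcR in e0.
near=> b; rewrite /ball /= -rmorphB /= normc_def /= expr0n addr0 sqrtr_sqr eE ltcR.
near: b; apply/nbhs_ballP; exists (complex.Re e) => //=.
Unshelve. all: by end_near. Qed.

Let rscale_continuous : continuous (fun z : R^o * ER => z.1 *: z.2).
Proof.
move=> [a x].
have c1 : (fun z : R^o * ER => (z.1%:C : R[i]^o)) @ (a, x) --> (a%:C : R[i]^o).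
  apply: (@cvg_comp _ _ _ fst (fun b : R => (b%:C : R[i]^o)) _ (nbhs a)).
    exact: cvg_fst.
  exact: real_complex_continuous.
have c2 : (fun z : R^o * ER => (z.2 : E)) @ (a, x) --> (x : E) by exact: cvg_snd.
apply: (@cvg_comp _ _ _ (fun z : R^o * ER => (z.1%:C : R[i]^o, z.2 : E))
  (fun z : R[i]^o * E => z.1 *: z.2) _ (nbhs (a%:C : R[i]^o, x : E))).
  exact: cvg_pair c1 c2.
exact: (@scale_continuous _ E (a%:C, x)).
Qed.

Let rlocally_convex : exists2 B : set_system ER,
  (forall b, b \in B -> convex_set b) & basis B.
Proof.
have [B Bc Bb] := @locally_convex R[i] E; exists B => // b bB x y l xb yb.
have l0 : 0 <= (l%:num%:C : R[i]) by rewrite lecR.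
have l1 : (l%:num%:C : R[i]) <= 1 by rewrite lecR.
have : l%:num%:C *: (x : E) + (1 - l%:num%:C) *: (y : E) \in b.
  exact: Bc b bB x y (Itv01 l0 l1) xb yb.
have -> : 1 - l%:num%:C = (1 - l%:num)%:C :> R[i] by rewrite rmorphB.
exact.
Qed.

HB.instance Definition _ :=
  PreTopologicalNmodule_isTopologicalNmodule.Build ER radd.
HB.instance Definition _ :=
  TopologicalNmodule_isTopologicalLmodule.Build R ER rscale_continuous.
HB.instance Definition _ := Uniform_isTvs.Build R ER rlocally_convex.
HB.instance Definition _ := isHausdorff.Build ER (@hausdorff_subproof R[i] E).
End Realification.

Variant lcs (R : realType) :=
  | RealLcs of lcsType R
  | ComplexLcs of lcsType R[i].

Definition real_lcs (R : realType) (E : lcs R) : lcsType R :=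
  match E with
  | RealLcs E => E
  | ComplexLcs E => realification R E
  end.

Coercion real_lcs : lcs >-> LocallyConvex.type.

Lemma open_setX (T U : topologicalType) (A : set T) (B : set U) :
  open A -> open B -> open (A `*` B).
Proof.
rewrite !openE => oA oB [x y] [/= /oA Ax /oB By].
by exists (A, B); first by split.
Qed.

(** Functions on an open subset [U] of [E] are represented by total functions on
    [E] whose values outside [U] are irrelevant.  The definitions only use the
    vector space operations and the topology, hence are stated for
    [preTopologicalLmodType]; this makes them apply to the function spaces
    [Cr_space] below without first proving those to be locally convex. *)
Section Differentiability.
Context {R : realType}.
Implicit Types E F : preTopologicalLmodType R.

Definition diffq E F (f : E -> F) (x h : E) (t : R) : F :=
  t^-1 *: (f (x + t *: h) - f x).

(** [dd f (x, h)] is the limit of [diffq f x h] at 0 if it exists; it is only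
    used for Hausdorff [F], where the limit is unique. *)
Definition dd E F (f : E -> F) (p : (E * E)%type) : F :=
  xget 0 [set l : F | diffq f p.1 p.2 @ 0^' --> l].

Definition is_C0 E F (U : set E) (f : E -> F) := {within U, continuous f}.

Definition is_C1 E F (U : set E) (f : E -> F) :=
  [/\ is_C0 U f,
      forall x h, U x -> exists l : F, diffq f x h @ 0^' --> l
    & is_C0 (E := (E * E)%type) (U `*` [set: E]) (dd f)].

(** [pow2 n E] is E^(2^n), and [pow2_dom n U] is U x E^(2^n - 1). *)
Fixpoint pow2 (n : nat) E : preTopologicalLmodType R :=
  if n is m.+1 then (pow2 m E * pow2 m E)%type else E.

Fixpoint pow2_dom (n : nat) E (U : set E) : set (pow2 n E) :=
  if n is m.+1 return set (pow2 n E) then @pow2_dom m E U `*` [set: pow2 m E]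
  else U.

Fixpoint dn (n : nat) E F (f : E -> F) : pow2 n E -> F :=
  if n is m.+1 return pow2 n E -> F then dd (@dn m E F f) else f.

Arguments pow2_dom n {E} U.
Arguments dn n {E F} f.

Fixpoint is_Cn (n : nat) E F (U : set E) (f : E -> F) : Prop :=
  if n is m.+1 then @is_Cn m E F U f /\ is_C1 (pow2_dom m U) (dn m f)
  else is_C0 U f.

Definition is_Ck (k : natinf) E F (U : set E) (f : E -> F) : Prop :=
  forall n, le_natinf n k -> is_Cn n U f.

Definition d2 (X : Type) E F (j : nat) (f : X * E -> F)
    (p : X * pow2 j E) : F :=
  dn j (fun y => f (p.1, y)) p.2.

Arguments d2 {X E F} j f p.

Definition partially_Ck (k : natinf) (X : topologicalType) E F
    (f : X * E -> F) : Prop :=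
  (forall x, is_Ck k [set: E] (fun y => f (x, y))) /\
  (forall j, le_natinf j k -> continuous (d2 j f)).

End Differentiability.

Arguments pow2_dom {R} n {E} U.
Arguments dn {R} n {E F} f.
Arguments d2 {R X E F} j f p.

Section ChartedSpaces.
Context {R : realType}.
Implicit Types E F M : preTopologicalLmodType R.

(** The raw data of a space with charts [chart i] from the subset [chart_dom i]
    of the space to the open subset [chart_cod i] of [M]; [is_atlas r] below says
    that they form a C^r-atlas. *)
Record chartedSpace M := ChartedSpace {
  carrier :> topologicalType;
  chart_idx : Type;
  chart_dom : chart_idx -> set carrier;
  chart_cod : chart_idx -> set M;
  chart : chart_idx -> carrier -> M;
  chart_cod_open : forall i, open (chart_cod i)
}.

(** [in_chart g i] is the composition of [g] with the inverse of [chart i],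
    extended by 0 outside [chart_cod i]. *)
Definition chart_inv M (X : chartedSpace M) (i : chart_idx X) (y : M) :
    option X :=
  xget None [set o | exists2 x, chart_dom i x /\ chart i x = y & o = Some x].

Definition in_chart M (X : chartedSpace M) (T : lmodType R) (g : X -> T)
    (i : chart_idx X) (y : M) : T :=
  oapp g 0 (chart_inv i y).

Record is_atlas (r : natinf) M (X : chartedSpace M) : Prop := IsAtlas {
  chart_cover : forall x : X, exists i, chart_dom i x;
  chart_dom_open : forall i : chart_idx X, open (chart_dom i);
  chart_image : forall i : chart_idx X, chart i @` chart_dom i = chart_cod i;
  chart_inj : forall i : chart_idx X,
    {in chart_dom i &, injective (chart (c := X) i)};
  chart_continuous : forall i : chart_idx X,
    {within chart_dom i, continuous (chart i)};
  chart_open_map : forall (i : chart_idx X) (A : set X),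
    open A -> A `<=` chart_dom i -> open (chart i @` A);
  chart_transition : forall i j : chart_idx X,
    is_Ck r (chart i @` (chart_dom i `&` chart_dom j)) (in_chart (chart j) i)
}.

(** A tangent vector at [foot] is given by its representatives [tvec i] in all
    charts around [foot], which correspond to each other under the derivatives
    of the chart changes; for the other charts [tvec i] is normalised to 0. *)
Record tangent M (X : chartedSpace M) := Tangent {
  foot : X;
  tvec : chart_idx X -> M;
  tvec_out : forall i, ~ chart_dom i foot -> tvec i = 0;
  tvec_compat : forall i j, chart_dom i foot -> chart_dom j foot ->
    tvec j = dd (in_chart (chart j) i) (chart i foot, tvec i)
}.

HB.instance Definition _ M (X : chartedSpace M) := gen_eqMixin (tangent X).
HB.instance Definition _ M (X : chartedSpace M) := gen_choiceMixin (tangent X).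

Definition tchart M (X : chartedSpace M) (i : chart_idx X) (p : tangent X) :
    (M * M)%type :=
  (chart i (foot p), tvec p i).

(** A set is open in TX iff its trace on each T(chart_dom i) is open when read in
    the chart T(chart i). *)
Section TangentTopology.
Variables (M : preTopologicalLmodType R) (X : chartedSpace M).

Definition tangent_open : set_system (tangent X) := [set A |
  forall i : chart_idx X, exists2 W : set (M * M), open W &
    forall p, chart_dom i (foot p) -> (A p <-> W (tchart i p))].

Let tangent_openT : tangent_open [set: tangent X].
Proof. by move=> i; exists setT => //; exact: openT. Qed.

Let tangent_openI : setI_closed tangent_open.
Proof.
move=> A B oA oB i; have [V oV AV] := oA i; have [W oW BW] := oB i.
exists (V `&` W); first exact: openI.
by move=> p ip; split=> -[/AV-/(_ ip) ? /BW-/(_ ip) ?].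
Qed.

Let tangent_open_bigU (I : Type) (A : I -> set (tangent X)) :
  (forall a, tangent_open (A a)) -> tangent_open (\bigcup_a A a).
Proof.
move=> oA i; have /choice[W oW] : forall a, exists W : set (M * M), open W /\
    forall p, chart_dom i (foot p) -> (A a p <-> W (tchart i p)).
  by move=> a; have [W ? ?] := oA a i; exists W.
exists (\bigcup_a W a); first by apply: bigcup_open => a _; exact: (oW a).1.
by move=> p ip; split=> -[a _ /(oW a).2-/(_ ip) ?]; exists a.
Qed.

HB.instance Definition _ := isOpenTopological.Build (tangent X)
  tangent_openT tangent_openI tangent_open_bigU.

Let tchart_cod_open (i : chart_idx X) :
  open (chart_cod i `*` [set: M] : set (M * M)).
Proof. exact: open_setX (chart_cod_open i) openT. Qed.

Definition tangent_bundle : chartedSpace (M * M)%type := @ChartedSpace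
  (M * M)%type (tangent X) (chart_idx X)
  (fun i => [set p | chart_dom i (foot p)])
  (fun i => chart_cod i `*` [set: M])
  (@tchart M X) tchart_cod_open.

End TangentTopology.

Fixpoint iter_tangent (n : nat) M (X : chartedSpace M) :
    chartedSpace (pow2 n M) :=
  if n is m.+1 return chartedSpace (pow2 n M)
  then tangent_bundle (@iter_tangent m M X) else X.

(** The tangent map TX -> TE = E x E, computed in any chart around the foot point;
    for [g] of class C^1 the value does not depend on the chart. *)
Definition tangent_map M (X : chartedSpace M) E (g : X -> E)
    (p : tangent_bundle X) : (E * E)%type :=
  (g (foot p),
   xget 0 [set dd (in_chart g i) (tchart i p) |
           i in [set i | chart_dom i (foot p)]]).

Definition dmap M (X : chartedSpace M) E (g : X -> E) : tangent_bundle X -> E :=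
  snd \o tangent_map g.

Arguments iter_tangent n {M} X.

Fixpoint dnmap (n : nat) M (X : chartedSpace M) E (g : X -> E) :
    iter_tangent n X -> E :=
  if n is m.+1 return iter_tangent n X -> E
  then dmap (@dnmap m M X E g) else g.

(** For r = 0 only the topology of [X] matters. *)
Definition is_Cr_map (r : natinf) M (X : chartedSpace M) E (g : X -> E) : Prop :=
  continuous g /\
  (le_natinf 1 r -> forall i, is_Ck r (chart_cod i) (in_chart g i)).

Section ProductCharts.
Variables (M : preTopologicalLmodType R) (X : chartedSpace M).
Variable E : preTopologicalLmodType R.

Let prod_cod_open (i : chart_idx X) :
  open (chart_cod i `*` [set: E] : set (M * E)).
Proof. exact: open_setX (chart_cod_open i) openT. Qed.

Definition prod_charted : chartedSpace (M * E)%type := @ChartedSpace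
  (M * E)%type (X * E)%type (chart_idx X)
  (fun i => chart_dom i `*` [set: E])
  (fun i => chart_cod i `*` [set: E])
  (fun i p => (chart i p.1, p.2)) prod_cod_open.

End ProductCharts.

End ChartedSpaces.

Arguments iter_tangent {R} n {M} X.
Arguments dnmap {R} n {M X E} g _.
Arguments is_Cr_map {R} r {M} X {E} g.

Section Linearity.
Context {R : realType}.
Implicit Types E F : preTopologicalLmodType R.

(* The C^r-maps form a vector subspace of the space of all maps. *)
Let lines_continuous E :=
  forall x h : E, (fun t : R => x + t *: h) @ 0 --> x.

Let lines_continuous_pow2 n E :
  lines_continuous E -> lines_continuous (pow2 n E).
Proof.
move=> cE; elim: n => [//|n IHn] -[x1 x2] [h1 h2].
exact: cvg_pair (IHn x1 h1) (IHn x2 h2).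
Qed.

Let cvg_scale (E : topologicalLmodType R) (T : Type) (G : set_system T)
    (c : T -> R) (p : T -> E) (a : R) (l : E) :
  Filter G -> c @ G --> a -> p @ G --> l -> (fun t => c t *: p t) @ G --> a *: l.
Proof.
move=> FG ca pl.
apply: (@cvg_comp _ _ _ (fun t => (c t, p t)) (fun z : R^o * E => z.1 *: z.2)
  _ (nbhs (a : R^o, l)) (nbhs (a *: l))).
  exact: cvg_pair ca pl.
exact: (@scale_continuous R E (a, l)).
Qed.

Let cvg_add (E : topologicalLmodType R) (T : Type) (G : set_system T)
    (p q : T -> E) (l m : E) :
  Filter G -> p @ G --> l -> q @ G --> m -> (fun t => p t + q t) @ G --> l + m.
Proof.
move=> FG pl qm.
apply: (@cvg_comp _ _ _ (fun t => (p t, q t)) (fun z : E * E => z.1 + z.2)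
  _ (nbhs (l, m)) (nbhs (l + m))).
  exact: cvg_pair pl qm.
exact: (@add_continuous E (l, m)).
Qed.

Let lines_continuous_top (E : topologicalLmodType R) : lines_continuous E.
Proof.
move=> x h; rewrite -[X in _ --> X]addr0 -(scale0r h).
by apply: cvg_add; [exact: cvg_cst|apply: cvg_scale => //; exact: cvg_cst].
Qed.

Let pow2_dom_open n E (U : set E) : open U -> open (pow2_dom n U).
Proof. by move=> oU; elim: n => [//|n IHn]; exact: open_setX IHn openT. Qed.

Section Target.
Variable F : lcsType R.

Let cvg_lin (T : Type) (G : set_system T) (p q : T -> F) (a : R) (l m : F) :
  Filter G -> p @ G --> l -> q @ G --> m ->
  (fun t => a *: p t + q t) @ G --> a *: l + m.
Proof.
by move=> FG pl qm; apply: cvg_add => //; apply: cvg_scale => //; exact: cvg_cst.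
Qed.

Let dd_eq E (f : E -> F) x h l :
  diffq f x h @ 0^' --> l -> dd f (x, h) = l.
Proof.
move=> fl; apply: xget_unique => //= m fm.
exact: (cvg_unique (@hausdorff_subproof R F) fm fl).
Qed.

Let is_C0_lin E (W : set E) (f g u : E -> F) (a : R) :
  {in W, forall x, u x = a *: f x + g x} ->
  is_C0 W f -> is_C0 W g -> is_C0 W u.
Proof.
move=> uE cf cg.
have c : {within W, continuous (fun x => a *: f x + g x)}.
  by move=> x; apply: cvg_lin; [exact: cf|exact: cg].
by apply: subspace_eq_continuous c => x /uE.
Qed.

Let is_C1_lin E (W : set E) (f g u : E -> F) (a : R) :
  lines_continuous E -> open W -> {in W, forall x, u x = a *: f x + g x} ->
  is_C1 W f -> is_C1 W g -> is_C1 W u /\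
  {in (W `*` [set: E])%classic, forall p, dd u p = a *: dd f p + dd g p}.
Proof.
move=> cE oW uE [f0 f1 f2] [g0 g1 g2].
have key x h l m : W x -> diffq f x h @ 0^' --> l -> diffq g x h @ 0^' --> m ->
    diffq u x h @ 0^' --> a *: l + m.
  move=> Wx fl gm.
  have L : (fun t => a *: diffq f x h t + diffq g x h t) @ 0^' --> a *: l + m.
    exact: cvg_lin.
  apply: cvg_trans L; apply: near_eq_cvg.
  have : \forall t \near (0 : R)^', W (x + t *: h).
    by apply: cvg_within; apply: cE; exact: open_nbhs_nbhs.
  apply: filterS => t Wt; rewrite /diffq !uE ?inE// scalerA mulrC -scalerA.
  by rewrite -scalerDr opprD addrACA scalerBr.
have ddE : {in (W `*` [set: E])%classic, forall p, dd u p = a *: dd f p + dd g p}.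
  move=> [x h]; rewrite inE => -[/= Wx _].
  have [l fl] := f1 x h Wx; have [m gm] := g1 x h Wx.
  by rewrite (dd_eq fl) (dd_eq gm) (dd_eq (key _ _ _ _ Wx fl gm)).
split => //; split; [exact: is_C0_lin uE f0 g0| |exact: is_C0_lin ddE f2 g2].
move=> x h Wx; have [l fl] := f1 x h Wx; have [m gm] := g1 x h Wx.
by exists (a *: l + m); exact: key.
Qed.

Let is_Cn_lin E (U : set E) (f g : E -> F) (a : R) n :
  lines_continuous E -> open U -> is_Cn n U f -> is_Cn n U g ->
  is_Cn n U (fun x => a *: f x + g x) /\
  {in pow2_dom n U, forall p,
    dn n (fun x => a *: f x + g x) p = a *: dn n f p + dn n g p}.
Proof.
move=> cE oU; elim: n => [|n IHn] /=.
  by move=> f0 g0; split=> //; exact: is_C0_lin f0 g0.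
move=> [fn f1] [gn g1]; have [un uE] := IHn fn gn.
have [//||u1 uE1] := is_C1_lin _ _ uE f1 g1.
- exact: lines_continuous_pow2.
- exact: pow2_dom_open.
by split.
Qed.

Let is_Cn0 E (U : set E) n :
  is_Cn n U (fun _ : E => 0 : F) /\ dn n (fun _ : E => 0 : F) = (fun _ : pow2 n E => 0 : F).
Proof.
have d0 (E' : preTopologicalLmodType R) (x h : E') : diffq (fun _ : E' => 0 : F) x h @ 0^' --> (0 : F).
  rewrite (_ : diffq _ _ _ = fun=> 0); first exact: cvg_cst.
  by apply/funext => t; rewrite /diffq subrr scaler0.
have dd0 (E' : preTopologicalLmodType R) : dd (fun _ : E' => 0 : F) = (fun=> 0 : F).
  by apply/funext => -[x h]; exact: dd_eq.
have c0 (E' : preTopologicalLmodType R) (W : set E') : is_C0 W (fun _ : E' => 0 : F) by move=> x; exact: cvg_cst.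
elim: n => [|n [IHn dn0]] /=; first by split.
rewrite dn0 dd0; split => //; split => //; split => //; last by rewrite dd0.
by move=> x h _; exists 0.
Qed.

Variables (r : natinf) (M : lcsType R) (X : chartedSpace M).

Lemma is_Cr_map0 : is_Cr_map r X (fun=> 0 : F).
Proof.
split=> [x|_ i n _]; first exact: cvg_cst.
rewrite (_ : in_chart _ _ = fun=> 0); first by have [] := is_Cn0 (chart_cod i) n.
by apply/funext => y; rewrite /in_chart; case: chart_inv.
Qed.

Lemma is_Cr_map_lin (a : R) (g h : X -> F) :
  is_Cr_map r X g -> is_Cr_map r X h -> is_Cr_map r X (fun x => a *: g x + h x).
Proof.
move=> [g0 gr] [h0 hr]; split=> [x|r1 i n nr].
  by apply: cvg_lin; [exact: g0|exact: h0].
rewrite (_ : in_chart _ _ = fun y => a *: in_chart g i y + in_chart h i y).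
  have [] // := is_Cn_lin a (@lines_continuous_top M) (chart_cod_open i)
    (gr r1 i n nr) (hr r1 i n nr).
apply/funext => y; rewrite /in_chart; case: chart_inv => //=.
by rewrite scaler0 addr0.
Qed.

End Target.
End Linearity.

Section FunctionSpace.
Context {R : realType}.
Variables (r : natinf) (M : lcsType R) (X : chartedSpace M) (E : lcsType R).

Definition Cr_pred : {pred X -> E} := mem [set g | is_Cr_map r X g].

Record Cr_space := MkCr { Cr_fun :> X -> E; Cr_funP : Cr_fun \in Cr_pred }.

Let Cr_submod : submod_closed Cr_pred.
Proof.
split=> [|a g h]; first by rewrite inE; exact: is_Cr_map0.
by rewrite !inE; exact: is_Cr_map_lin.
Qed.

HB.instance Definition _ :=
  GRing.isSubmodClosed.Build R (X -> E) Cr_pred Cr_submod.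

HB.instance Definition _ := [isSub for Cr_fun].
HB.instance Definition _ := [Choice of Cr_space by <:].
HB.instance Definition _ := [SubChoice_isSubLmodule of Cr_space by <:].

(** The initial topology with respect to the maps g |-> d^n g, n <= r. *)
Definition Cr_topology : Type :=
  sup_topology (fun n : {n : nat | le_natinf n r} => Topological.class
    (initial_topology (fun g : Cr_space =>
      dnmap (sval n) g : {compact-open, iter_tangent (sval n) X -> E}))).

HB.instance Definition _ := Topological.copy Cr_space Cr_topology.

End FunctionSpace.

(* Main.v *)
Require Import Defs.
From mathcomp Require Import all_boot all_order all_algebra.
From mathcomp Require Import all_classical all_reals all_analysis.
From mathcomp Require Import lra.

Set Implicit Arguments.
Unset Strict Implicit.
Unset Printing Implicit Defensive.

Import Order.TTheory GRing.Theory Num.Theory.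
Import numFieldTopology.Exports.

Local Open Scope classical_set_scope.
Local Open Scope ring_scope.

(** Call superposition operator of f the map sending g to x |-> f (x, g x).

The iterated differential d^j of this operator should be the superposition
operator of d2 j f, so the theorem comes down to two facts about functions of
class C^r on X x E: their superposition operators are continuous, and if f0
has the partial differential f1 in its second argument, then the operator of f0
is differentiable and its differential sends (g, h) to x |-> f1 (x, (g x, h x)).
The induction on j replaces E by E^(2^j).  Instead of identifying
C^r(X, E)^(2^j) with C^r(X, E^(2^j)), both facts are proved over an arbitrary
space S of parameters that carries a linear evaluation S -> C^r(X, E)
(superpose_continuous, superpose_diffq).

Continuity.  Compact-open convergence of g_t to a continuous g0 means that for
every compact K and v in K, g_t x tends to g0 v when t runs along its filter and
x tends to v inside K (cconv_compact_open).  In this form convergence is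
preserved by composition with continuous maps.  Read in charts, convergence in
C^r(X, E) is convergence of this kind for all iterated differentials (cvg_CrP),
and the chain rule d(f o g)(x, h) = df(g x, dg(x, h)) shows by induction on the
order that it is preserved by composition with C^n-maps (jet_conv_comp).

Differentiability.  Put u_t x = f0 (x, g x + t h x) and
v_t x = f1 (x, (g x + t h x, h x)), so that v_t x is the derivative of u_t x with
respect to t.  By the continuity argument v and its iterated differentials in x
depend jointly continuously on t and x.  Hence differentiation in t commutes
with differentiation in x (schwarz): the n-th differential of u has the n-th
differential of v as its t-derivative.  The mean value theorem turns the joint
continuity of the latter into convergence of the difference quotients of the
former (cconv_quot, jet_conv_quot).  The mean value theorem used is the purely
convex one (mvt_convex): the increment of a curve over [0, 1] lies in each convex
set that is a neighbourhood of all its derivatives.  It does the work of the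
integral of the derivative, which need not exist in an incomplete space.

Charts.  The tangent bundle of a manifold of class C^(n+1) is one of class C^n
(tangent_atlas), and the differential of a map is read in the chart of TX as the
differential of its chart representation (in_chart_dmap).  Compact sets are
moved between T^n X and its charts by cutting them into compact pieces, each
inside a chart domain (compact_cut). *)

(** * Locally convex spaces and the mean value theorem *)

Section Lctvs.
Context {R : realType}.
Implicit Types E F : preTopologicalLmodType R.

Definition convex_subset E (V : set E) := forall (x y : E) (a b : R),
  0 <= a -> 0 <= b -> a + b = 1 -> V x -> V y -> V (a *: x + b *: y).

(** The iterated tangent objects [pow2 n E] are only known to the type system
as [preTopologicalLmodType]s, so that being locally convex and Hausdorff is
carried by a predicate, and is found by instance resolution. *)
Class lctvs E : Prop := Lctvs {
  lctvs_add : continuous (fun z : E * E => z.1 + z.2);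
  lctvs_scale : continuous (fun z : R^o * E => z.1 *: z.2);
  lctvs_convex : forall U : set E, nbhs 0 U ->
    exists V : set E, [/\ nbhs 0 V, V `<=` U & convex_subset V];
  lctvs_hausdorff : hausdorff_space E
}.

Section Limits.
Context {E} {lE : lctvs E} {T : Type} {G : set_system T} {FG : Filter G}.

Lemma lcvgD (p q : T -> E) (l m : E) :
  p @ G --> l -> q @ G --> m -> (fun t => p t + q t) @ G --> l + m.
Proof.
move=> pl qm.
apply: (@cvg_comp _ _ _ (fun t => (p t, q t)) (fun z : E * E => z.1 + z.2)
  _ (nbhs (l, m)) (nbhs (l + m))); first exact: cvg_pair pl qm.
exact: (@lctvs_add E lE (l, m)).
Qed.

Lemma lcvgZ (c : T -> R) (p : T -> E) (a : R) (l : E) :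
  c @ G --> a -> p @ G --> l -> (fun t => c t *: p t) @ G --> a *: l.
Proof.
move=> ca pl.
apply: (@cvg_comp _ _ _ (fun t => (c t, p t)) (fun z : R^o * E => z.1 *: z.2)
  _ (nbhs (a : R^o, l)) (nbhs (a *: l))); first exact: cvg_pair ca pl.
exact: (@lctvs_scale E lE (a, l)).
Qed.

Lemma lcvgZr (a : R) (p : T -> E) (l : E) :
  p @ G --> l -> (fun t => a *: p t) @ G --> a *: l.
Proof. by apply: lcvgZ; exact: cvg_cst. Qed.

Lemma lcvgN (p : T -> E) (l : E) : p @ G --> l -> (fun t => - p t) @ G --> - l.
Proof.
rewrite -scaleN1r => pl.
by rewrite (_ : (fun t => - p t) = fun t => -1 *: p t);
  [exact: lcvgZr|apply/funext => t; rewrite scaleN1r].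
Qed.

Lemma lcvgB (p q : T -> E) (l m : E) :
  p @ G --> l -> q @ G --> m -> (fun t => p t - q t) @ G --> l - m.
Proof. by move=> pl qm; apply: lcvgD => //; exact: lcvgN. Qed.

End Limits.

Lemma lcvg_unique E (lE : lctvs E) T (G : set_system T) {FG : ProperFilter G}
  (p : T -> E) (l m : E) : p @ G --> l -> p @ G --> m -> l = m.
Proof. exact: (cvg_unique lctvs_hausdorff). Qed.

#[global] Instance lctvs_lcs (E : lcsType R) : lctvs E.
Proof.
split; [exact: add_continuous|exact: scale_continuous| |exact: hausdorff_subproof].
move=> U U0; have [B Bc [Bo Bb]] := @locally_convex R E.
have [V [BV V0] VU] := Bb 0 U U0.
exists V; split=> //; first by apply: open_nbhs_nbhs; split=> //; exact: Bo.
move=> x y a b a0 b0 ab Vx Vy.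
have a1 : a <= 1 by lra.
have -> : b = 1 - a by lra.
apply: set_mem.
exact: (Bc V (mem_set BV) x y (Itv01 a0 a1) (mem_set Vx) (mem_set Vy)).
Qed.

#[global] Instance lctvs_prod E F (lE : lctvs E) (lF : lctvs F) :
  lctvs (E * F)%type.
Proof.
split.
- move=> [[a b] [c d]]; apply: cvg_pair => /=.
    apply: lcvgD; [apply: (cvg_comp fst fst)|apply: (cvg_comp snd fst)];
    [exact: cvg_fst|exact: cvg_fst|exact: cvg_snd|exact: cvg_fst].
  apply: lcvgD; [apply: (cvg_comp fst snd)|apply: (cvg_comp snd snd)];
    [exact: cvg_fst|exact: cvg_snd|exact: cvg_snd|exact: cvg_snd].
- move=> [a [x y]]; apply: cvg_pair => /=.
    apply: lcvgZ; first exact: cvg_fst.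
    by apply: (cvg_comp snd fst); [exact: cvg_snd|exact: cvg_fst].
  apply: lcvgZ; first exact: cvg_fst.
  by apply: (cvg_comp snd snd); [exact: cvg_snd|exact: cvg_snd].
- move=> U [[/= A B] [A0 B0] ABU].
  have [V [V0 VA cV]] := lctvs_convex A0.
  have [W [W0 WB cW]] := lctvs_convex B0.
  exists (V `*` W); split.
  + by exists (V, W).
  + by move=> [x y] [/= /VA Ax /WB By]; apply: ABU.
  + move=> [x y] [x' y'] a b a0 b0 ab [/= Vx Wy] [/= Vx' Wy'].
    by split; [exact: cV|exact: cW].
- move=> [x y] [x' y'] cl; congr pair; apply: lctvs_hausdorff => A B Ax Bx.
    have [||[z1 z2] [/= [? _] [? _]]] := cl (A `*` setT) (B `*` setT).
    + by exists (A, setT) => //; split=> //; exact: filterT.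
    + by exists (B, setT) => //; split=> //; exact: filterT.
    by exists z1.
  have [||[z1 z2] [/= [_ ?] [_ ?]]] := cl (setT `*` A) (setT `*` B).
  + by exists (setT, A) => //; split=> //; exact: filterT.
  + by exists (setT, B) => //; split=> //; exact: filterT.
  by exists z2.
Qed.

#[global] Instance lctvs_pow2 n E (lE : lctvs E) : lctvs (pow2 n E).
Proof. by elim: n => //= n IHn; exact: lctvs_prod. Qed.

Lemma lctvs_shift E (lE : lctvs E) (c : E) (U : set E) :
  nbhs c U -> nbhs 0 [set x | U (c + x)].
Proof.
move=> cU; suff : (fun x => c + x) @ (0 : E) --> c by apply.
rewrite -[X in _ --> X]addr0; apply: lcvgD; first exact: cvg_cst.
exact: cvg_id.
Qed.

Lemma lctvs_regular E (lE : lctvs E) (c : E) (U : set E) :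
  nbhs c U -> exists V, [/\ nbhs c V, closed V & V `<=` U].
Proof.
move=> cU.
have sub0 : (fun z : E * E => z.1 - z.2) @ (0, 0) --> (0 : E).
  by rewrite -[X in _ --> X](subrr 0); apply: lcvgB; [exact: cvg_fst|exact: cvg_snd].
have [[/= A B] [A0 B0] AB] := sub0 _ (lctvs_shift lE cU).
have tr x : (fun y => y - x) @ x --> (0 : E).
  by rewrite -[X in _ --> X](subrr x); apply: lcvgB; [exact: cvg_id|exact: cvg_cst].
exists (closure [set x | A (x - c)]); split.
- have Ac : nbhs c [set x | A (x - c)] by exact: tr.
  by apply: filterS Ac; exact: subset_closure.
- exact: closed_closure.
- move=> x xA.
  have /xA[y [/= Ay By]] : nbhs x [set y | B (y - x)] by exact: tr.
  have /= := AB (y - c, y - x) (conj Ay By).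
  have -> : c + (y - c - (y - x)) = x.
    by rewrite opprB addrA [c + _]addrC subrK addrC subrK.
  exact.
Qed.

Definition curve_deriv F (phi : R -> F) (t : R) (l : F) :=
  (fun h : R => h^-1 *: (phi (t + h) - phi t)) @ 0^' --> l.

(** Call q s t the slope of phi between s and t.  Near each s the
slopes q s t lie in W because they tend to the derivative, and q r t is a convex
combination of q r s and q s t.  Hence the supremum of the t in ]0, 1] for which
q 0 t lies in W is attained and equals 1. *)
Lemma mvt_convex F (W : set F) (phi dphi : R -> F) : convex_subset W ->
  (forall t : R, 0 <= t <= 1 -> curve_deriv phi t (dphi t)) ->
  (forall t : R, 0 <= t <= 1 -> nbhs (dphi t) W) ->
  W (phi 1 - phi 0).
Proof.
move=> cW drv nW.
pose q s t := (t - s)^-1 *: (phi t - phi s).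
have qC s t : q s t = q t s.
  by rewrite /q -[t - s]opprB -[phi t - _]opprB invrN scaleNr scalerN opprK.
have loc s : 0 <= s <= 1 -> exists2 d : R, 0 < d &
    forall t, t != s -> `|t - s| < d -> W (q s t).
  move=> s01; have /nbhs_ballP[d /= d0 dW] := drv s s01 W (nW s s01).
  exists d => // t ts td.
  have := dW (t - s); rewrite /ball /= sub0r normrN subr_eq0 => /(_ td ts) /=.
  by rewrite [s + _]addrC subrK.
have qW r s t : r < s -> s < t -> W (q r s) -> W (q s t) -> W (q r t).
  move=> rs st Wr Wt.
  have -> : q r t = ((s - r) / (t - r)) *: q r s + ((t - s) / (t - r)) *: q s t.
    have rs' : s - r != 0 by rewrite subr_eq0 gt_eqF.
    have st' : t - s != 0 by rewrite subr_eq0 gt_eqF.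
    rewrite /q !scalerA [_ / _ * _]mulrAC divff// [_ / _ * _]mulrAC divff// mul1r.
    by rewrite -scalerDr [_ + (phi t - _)]addrC subrKA.
  apply: cW => //; rewrite ?divr_ge0 ?subr_ge0 ?(ltW rs) ?(ltW st) ?(ltW (lt_trans rs st))//.
  by rewrite -mulrDl addrC subrKA divff// subr_eq0 gt_eqF// (lt_trans rs st).
pose A := [set t : R | 0 < t <= 1 /\ W (q 0 t)].
have supA : has_sup A.
  split; last by exists 1 => t [/andP[]].
  have [|d d0 dW] := loc 0; first by rewrite lexx ler01.
  exists (Num.min 1 (d / 2)); split; first by rewrite lt_min ltr01 divr_gt0//= ge_min lexx.
  apply: dW; first by rewrite gt_eqF// lt_min ltr01 divr_gt0.
  rewrite subr0 gtr0_norm ?lt_min ?ltr01 ?divr_gt0//.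
  by rewrite gt_min; apply/orP; right; lra.
pose s := sup A.
have s1 : s <= 1 by apply: ge_sup; [case: supA|move=> t [/andP[]]].
have s0 : 0 < s.
  have [t At] := supA.1; have [/andP[t0 _] _] := At.
  by apply: lt_le_trans t0 _; exact: (ub_le_sup supA.2).
have s01 : 0 <= s <= 1 by rewrite (ltW s0).
have [d d0 dW] := loc s s01.
have Ws : W (q 0 s).
  have [t At st] := sup_adherent d0 supA; have [/andP[t0 t1] Wt] := At.
  have ts : t <= s by exact: (ub_le_sup supA.2).
  move: ts; rewrite le_eqVlt => /orP[/eqP <-//|ts].
  apply: (@qW _ t) => //; rewrite qC; apply: dW; first by rewrite lt_eqF.
  by rewrite ltr0_norm ?subr_lt0//; rewrite -/s in st; lra.
have [s1'|s1'] := ltP s 1; last first.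
  have es : s = 1 by lra.
  by move: Ws; rewrite es /q subr0 invr1 scale1r.
(* If s < 1, a further step of length h stays in [0, 1] and contradicts the supremum. *)
pose h := Num.min (d / 2) (1 - s).
have h0 : 0 < h by rewrite lt_min divr_gt0//= subr_gt0.
have hd : h <= d / 2 by rewrite ge_min lexx.
have h1 : h <= 1 - s by rewrite ge_min lexx orbT.
suff : A (s + h).
  move=> /(ub_le_sup supA.2); rewrite -/s; lra.
split; first lra.
apply: (@qW _ s) => //; first lra.
apply: dW; first by rewrite gt_eqF//; lra.
by rewrite addrC addKr gtr0_norm//; lra.
Qed.

(** Since U' depends on U and c only, and not on the curve, this can be
applied uniformly to families of curves. *)
Lemma mvt_nbhs F (lF : lctvs F) (c : F) (U : set F) : nbhs c U ->
  exists2 U', nbhs c U' & forall phi dphi : R -> F,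
    (forall t : R, 0 <= t <= 1 -> curve_deriv phi t (dphi t)) ->
    (forall t : R, 0 <= t <= 1 -> U' (dphi t)) -> U (phi 1 - phi 0).
Proof.
move=> cU; have [V [V0 VU cV]] := lctvs_convex (lctvs_shift lF cU).
pose W := [set x | V (x - c)].
have cW : nbhs c W.
  suff : (fun x => x - c) @ c --> (0 : F) by apply.
  by rewrite -[X in _ --> X](subrr c); apply: lcvgB; [exact: cvg_id|exact: cvg_cst].
exists (interior W); first exact: nbhs_interior.
move=> phi dphi drv dW.
have : W (phi 1 - phi 0).
  apply: mvt_convex drv dW => x y a b a0 b0 ab Wx Wy; rewrite /W /=.
  have -> : a *: x + b *: y - c = a *: (x - c) + b *: (y - c).
    by rewrite !scalerBr addrACA -opprD -scalerDl ab scale1r.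
  exact: cV.
by move=> /VU /=; rewrite addrC subrK.
Qed.

(** The substitute for exchanging a limit with the integral of dphi x
over [0, 1]. *)
Lemma mvt_cvg F (lF : lctvs F) T (G : set_system T) {FG : Filter G} (c : F)
  (phi dphi : T -> R -> F) :
  (\forall x \near G, forall t : R, 0 <= t <= 1 -> curve_deriv (phi x) t (dphi x t)) ->
  (forall U, nbhs c U -> \forall x \near G, forall t : R, 0 <= t <= 1 -> U (dphi x t)) ->
  (fun x => phi x 1 - phi x 0) @ G --> c.
Proof.
move=> drv dc U /(mvt_nbhs lF)[U' cU' UU'].
by move: (dc _ cU'); apply: filterS2 drv => x; exact: UU'.
Qed.

End Lctvs.

(** * Differential calculus on open sets *)

Section Calculus.
Context {R : realType}.
Implicit Types E F G : preTopologicalLmodType R.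

Lemma cvg_preimage_mem T U (f : T -> U) (G : set_system T) (H : set_system U) (A : set U) :
  f @ G --> H -> H A -> G (f @^-1` A).
Proof. by move=> fGH /fGH. Qed.

(** On an open set this agrees with continuity for the subspace topology
([cont_onP]), but spares the passage to subspaces. *)
Definition cont_on (S T : topologicalType) (U : set S) (f : S -> T) :=
  forall x, U x -> f @ x --> f x.

Lemma cont_onP (S T : topologicalType) (U : set S) (f : S -> T) : open U ->
  cont_on U f <-> {within U, continuous f}.
Proof.
move=> oU; rewrite continuous_open_subspace//; split=> cf x.
  by rewrite inE; exact: cf.
by move=> Ux; apply: cf; rewrite inE.
Qed.

Lemma cont_on_comp (S T Z : topologicalType) (U : set S) (V : set T)
  (f : T -> Z) (g : S -> T) : cont_on V f -> cont_on U g -> (forall x, U x -> V (g x)) ->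
  cont_on U (f \o g).
Proof. by move=> cf cg UV x Ux; apply: cvg_comp (cg x Ux) (cf _ (UV x Ux)). Qed.

Lemma cont_on_pair (S T Z : topologicalType) (U : set S)
  (f : S -> T) (g : S -> Z) : cont_on U f -> cont_on U g -> cont_on U (fun x => (f x, g x)).
Proof. by move=> cf cg x Ux; apply: cvg_pair; [exact: cf|exact: cg]. Qed.

Lemma cont_on_sub (S T : topologicalType) (U V : set S) (f : S -> T) :
  V `<=` U -> cont_on U f -> cont_on V f.
Proof. by move=> VU cf x /VU; exact: cf. Qed.

Lemma cont_on_ext (S T : topologicalType) (U : set S) (f g : S -> T) : open U ->
  (forall x, U x -> f x = g x) -> cont_on U f -> cont_on U g.
Proof.
move=> oU fg cf x Ux; rewrite -fg//; apply: cvg_trans (cf x Ux).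
apply: near_eq_cvg; have : nbhs x U by exact: open_nbhs_nbhs.
by apply: filterS => y /fg.
Qed.

Lemma cont_on_continuous (S T : topologicalType) (U : set S) (f : S -> T) :
  continuous f -> cont_on U f.
Proof. by move=> cf x _; exact: cf. Qed.

Lemma line_cvg E (lE : lctvs E) (x h : E) :
  (fun t : R => x + t *: h) @ 0^' --> x.
Proof.
rewrite -[X in _ --> X]addr0 -(scale0r h).
apply: lcvgD; first exact: cvg_cst.
by apply: lcvgZ; [exact: nbhs_dnbhs|exact: cvg_cst].
Qed.

Lemma line_near E (lE : lctvs E) (U : set E) (x h : E) : open U -> U x ->
  \forall t \near (0 : R)^', U (x + t *: h).
Proof. by move=> oU Ux; apply: line_cvg; exact: open_nbhs_nbhs. Qed.

Lemma dd_eq E F (lF : lctvs F) (f : E -> F) x h l :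
  diffq f x h @ 0^' --> l -> dd f (x, h) = l.
Proof. by move=> fl; apply: xget_unique => //= m fm; exact: lcvg_unique fm fl. Qed.

Definition deriv_on E F (U : set E) (f : E -> F) (f' : (E * E)%type -> F) :=
  forall x h, U x -> diffq f x h @ 0^' --> f' (x, h).

Lemma deriv_on_dd E F (lF : lctvs F) (U : set E) (f : E -> F) f' : deriv_on U f f' ->
  forall p, U p.1 -> dd f p = f' p.
Proof. by move=> df [x h] Ux; apply: dd_eq; exact: df. Qed.

Lemma diffq_ext E F (lE : lctvs E) (U : set E) (f g : E -> F) x h : open U ->
  (forall x, U x -> f x = g x) -> U x ->
  \forall t \near (0 : R)^', diffq f x h t = diffq g x h t.
Proof.
move=> oU fg Ux; have := line_near lE h oU Ux; apply: filterS => t Ut.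
by rewrite /diffq !fg.
Qed.

Lemma deriv_on_ext E F (lE : lctvs E) (U : set E) (f g : E -> F) f' : open U ->
  (forall x, U x -> f x = g x) -> deriv_on U f f' -> deriv_on U g f'.
Proof.
move=> oU fg df x h Ux; apply: cvg_trans (df x h Ux).
by apply: near_eq_cvg; exact: diffq_ext Ux.
Qed.

Lemma dd_ext E F (lE : lctvs E) (U : set E) (f g : E -> F) : open U ->
  (forall x, U x -> f x = g x) -> forall p, U p.1 -> dd f p = dd g p.
Proof.
move=> oU fg [x h] Ux; rewrite /dd; congr (xget 0 _); apply/seteqP.
split=> l /=; apply: cvg_trans; apply: near_eq_cvg; [apply: (@diffq_ext _ _ _ U)|
  apply: (@diffq_ext _ _ _ U)] => //.
by move=> y /fg.
Qed.

(** The argument t * c x ranges over the segment from 0 to c x; this is where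
joint continuity of psi yields the uniformity that [mvt_cvg] asks for. *)
Lemma near_segment T (G : set_system T) {FG : Filter G} Q (H : set_system Q)
  (Z : topologicalType) (c : T -> R) (q : T -> Q) (psi : R * Q -> Z) (z0 : Z) (U : set Z) :
  c @ G --> 0 -> q @ G --> H -> psi @ filter_prod (nbhs 0) H --> z0 -> nbhs z0 U ->
  \forall x \near G, forall t : R, 0 <= t <= 1 -> U (psi (t * c x, q x)).
Proof.
move=> c0 qq0 pz /pz[[/= A B] [A0 B0] AB].
have /nbhs_ballP[e /= e0 eA] := A0.
have : \forall x \near G, `|c x| < e.
  have : nbhs (0 : R) (ball 0 e) by exact: nbhsx_ballx.
  by move=> /(cvg_preimage_mem c0); apply: filterS => x; rewrite /ball /= sub0r normrN.
have := cvg_preimage_mem qq0 B0; apply: filterS2 => x Bx cx t /andP[t0 t1].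
apply: AB; split=> //=; apply: eA; rewrite /ball /= sub0r normrN normrM ger0_norm//.
by apply: le_lt_trans cx; rewrite ler_piMl.
Qed.

Lemma scale_dnbhs (c : R) : c != 0 -> (fun s : R => s * c) @ 0^' --> (0 : R)^'.
Proof.
move=> c0 A /nbhs_ballP[e /= e0 eA]; apply/nbhs_ballP.
exists (e / `|c|) => /=; first by rewrite divr_gt0// normr_gt0.
move=> s; rewrite /ball /= sub0r normrN ltr_pdivlMr ?normr_gt0// -normrM => se s0.
by apply: eA; rewrite /= ?mulf_neq0// /ball /= sub0r normrN.
Qed.

Lemma curve_deriv_line E F (V : set E) (f : E -> F) f'
  (y k : E) (c t : R) : c != 0 -> deriv_on V f f' -> V (y + (t * c) *: k) ->
  curve_deriv (fun t => c^-1 *: f (y + (t * c) *: k)) t (f' (y + (t * c) *: k, k)).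
Proof.
move=> c0 df Vt; rewrite /curve_deriv.
have -> : (fun h : R => h^-1 *: (c^-1 *: f (y + ((t + h) * c) *: k) -
    c^-1 *: f (y + (t * c) *: k))) = diffq f (y + (t * c) *: k) k \o (fun h => h * c).
  apply/funext => h /=; rewrite /diffq -scalerBr scalerA -invfM.
  by rewrite mulrDl scalerDl addrA.
by apply: cvg_comp (scale_dnbhs c0) _; exact: df.
Qed.

(** With k t the difference quotient of g at x, the one of f o g is the increment over
[0, 1] of the curve s |-> f (g x + (s t) k t) / t, whose derivative
f' (g x + (s t) k t, k t) tends to f' (g x, g' (x, h)) uniformly in s. *)
Lemma deriv_on_comp E F G (lE : lctvs E) (lF : lctvs F) (lG : lctvs G)
  (U : set E) (V : set F) (f : F -> G) (g : E -> F) f' g' : open V ->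
  deriv_on V f f' -> cont_on (V `*` setT) f' -> deriv_on U g g' ->
  (forall x, U x -> V (g x)) -> deriv_on U (f \o g) (fun p => f' (g p.1, g' p)).
Proof.
move=> oV df cf' dg UV x h Ux /=.
pose y := g x; pose k := diffq g x h; have kk : k @ 0^' --> g' (x, h) := dg x h Ux.
have kE t : t != 0 -> g (x + t *: h) = y + t *: k t.
  by move=> t0; rewrite /k /diffq scalerA mulfV// scale1r [y + _]addrC subrK.
have Vy : V y by exact: UV.
have t0 : (fun t : R => t) @ (0 : R)^' --> (0 : R) by exact: nbhs_dnbhs.
pose m (p : R * F) := y + p.1 *: p.2.
have cm : m @ (0 : R, g' (x, h)) --> y.
  rewrite -[X in _ --> X]addr0 -(scale0r (g' (x, h))).
  apply: lcvgD; first exact: cvg_cst.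
  by apply: lcvgZ; [exact: cvg_fst|exact: cvg_snd].
(* The factors 1 and 0 display the end points of the segment as values at s = 1 and s = 0. *)
have L : (fun t => t^-1 *: f (y + (1 * t) *: k t) -
    t^-1 *: f (y + (0 * t) *: k t)) @ (0 : R)^' --> f' (y, g' (x, h)).
  apply: (@mvt_cvg R G lG _ _ _ _ (fun t s => t^-1 *: f (y + (s * t) *: k t))
    (fun t s => f' (y + (s * t) *: k t, k t))).
    have : \forall t \near (0 : R)^', t != 0 by exact: nbhs_dnbhs_neq.
    have : \forall t \near (0 : R)^', forall s : R, 0 <= s <= 1 -> V (m (s * t, k t)).
      by apply: (near_segment t0 kk cm); exact: open_nbhs_nbhs.
    by apply: filterS2 => t Vt tn s s01; apply: curve_deriv_line df _ => //; exact: Vt.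
  move=> W cW; apply: (near_segment (psi := fun p => f' (m p, p.2)) t0 kk _ cW).
  apply: (@cvg_comp _ _ _ (fun p => (m p, p.2)) f' _ (nbhs (y, g' (x, h)))).
    by apply: cvg_pair; [exact: cm|exact: cvg_snd].
  by apply: (cf' (y, g' (x, h))); split.
apply: cvg_trans L; apply: near_eq_cvg.
have : \forall t \near (0 : R)^', t != 0 by exact: nbhs_dnbhs_neq.
apply: filterS => t tn; rewrite /diffq /= kE// mul1r mul0r scale0r addr0.
by rewrite -scalerBr.
Qed.

Definition linear_cont E F (l : E -> F) :=
  (forall a x y, l (a *: x + y) = a *: l x + l y) /\ continuous l.

Lemma deriv_on_lincomp E F G (U : set F) (g : F -> G) g'
  (l : E -> F) : linear_cont l -> deriv_on U g g' ->
  deriv_on (l @^-1` U) (g \o l) (fun p => g' (l p.1, l p.2)).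
Proof.
move=> [ll cl] dg x h Ux; rewrite (_ : diffq _ _ _ = diffq g (l x) (l h)).
  exact: dg.
by apply/funext => t; rewrite /diffq /= [x + _]addrC ll [_ + l x]addrC.
Qed.

Lemma deriv_on_lin E F (U : set E) (l : E -> F) :
  linear_cont l -> deriv_on U l (fun p => l p.2).
Proof.
move=> [ll cl] x h _; rewrite /diffq.
have L : (fun t : R => l h) @ (0 : R)^' --> l h by exact: cvg_cst.
apply: cvg_trans L; apply: near_eq_cvg.
have : \forall t \near (0 : R)^', t != 0 by exact: nbhs_dnbhs_neq.
by apply: filterS => t t0; rewrite [x + _]addrC ll addrK scalerA mulVf// scale1r.
Qed.

Lemma deriv_on_pair E F G (U : set E) (f : E -> F) (g : E -> G) f' g' :
  deriv_on U f f' -> deriv_on U g g' -> deriv_on U (fun x => (f x, g x)) (fun p => (f' p, g' p)).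
Proof. by move=> df dg x h Ux; apply: cvg_pair; [exact: df|exact: dg]. Qed.

(** The recursion goes through the differential, f being C^(n+1) iff it is C^1 and
dd f is C^n, whereas [is_Cn] goes through the last iterated differential.  This
is the form in which the chain rule can be iterated. *)
Fixpoint Cn_on (n : nat) E F (U : set E) (f : E -> F) : Prop :=
  cont_on U f /\
  if n is m.+1 then deriv_on U f (dd f) /\ @Cn_on m (E * E)%type F (U `*` setT) (dd f)
  else True.

Lemma Cn_on_cont n E F (U : set E) (f : E -> F) : Cn_on n U f -> cont_on U f.
Proof. by case: n => [|n] []. Qed.

Lemma Cn_on_W n E F (U : set E) (f : E -> F) : Cn_on n.+1 U f -> Cn_on n U f.
Proof.
elim: n E U f => [|n IHn] E U f; first by case=> cf _; split.
by move=> [cf [df ddf]]; split=> //; split=> //; exact: IHn.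
Qed.

Lemma Cn_on_le m n E F (U : set E) (f : E -> F) : (m <= n)%N -> Cn_on n U f -> Cn_on m U f.
Proof.
by elim: n => [|n IHn]; [case: m|rewrite leq_eqVlt => /orP[/eqP->//|/IHn h /Cn_on_W]].
Qed.

Lemma Cn_on_sub n E F (U V : set E) (f : E -> F) : V `<=` U -> Cn_on n U f -> Cn_on n V f.
Proof.
elim: n E U V f => [|n IHn] E U V f VU.
  by move=> [cf _]; split=> //; exact: cont_on_sub cf.
move=> [cf [df ddf]]; split; first exact: cont_on_sub cf.
split; first by move=> x h /VU; exact: df.
by apply: IHn ddf => -[x h] [/= /VU Ux _].
Qed.

Lemma Cn_on_ext n E F (lE : lctvs E) (U : set E) (f g : E -> F) : open U ->
  (forall x, U x -> f x = g x) -> Cn_on n U f -> Cn_on n U g.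
Proof.
elim: n E lE U f g => [|n IHn] E lE U f g oU fg.
  by move=> [cf _]; split=> //; exact: cont_on_ext cf.
move=> [cf [df ddf]]; split; first exact: cont_on_ext cf.
have ddE : forall p, U p.1 -> dd f p = dd g p by exact: dd_ext.
split; first by move=> x h Ux; rewrite -ddE//; exact: (deriv_on_ext lE oU fg df).
apply: IHn ddf; first exact: open_setX oU openT.
by move=> [x h] [/= Ux _]; exact: ddE.
Qed.

Lemma Cn_onS n E F (lE : lctvs E) (lF : lctvs F) (U : set E) (f : E -> F) f' :
  open U -> cont_on U f -> deriv_on U f f' -> Cn_on n (U `*` setT) f' -> Cn_on n.+1 U f.
Proof.
move=> oU cf df cf'; split=> //.
have ddE := deriv_on_dd lF df.
split; first by move=> x h Ux; rewrite ddE//; exact: df.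
apply: Cn_on_ext cf'; first exact: open_setX oU openT.
by move=> [x h] [/= Ux _]; rewrite ddE.
Qed.

Lemma open_cont_on_preimage (S T : topologicalType) (U : set S) (V : set T) (f : S -> T) :
  open U -> cont_on U f -> open V -> open (U `&` f @^-1` V).
Proof.
rewrite !openE => oU cf oV x [Ux Vx]; apply: filterI; first exact: oU.
by apply: cf => //; exact: oV.
Qed.

Lemma linear_cont_pair E F E' F' (l : E -> F) (m : E' -> F') : linear_cont l -> linear_cont m ->
  linear_cont (fun p : E * E' => (l p.1, m p.2)).
Proof.
move=> [ll cl] [lm cm]; split.
  by move=> a [x x'] [y y'] /=; rewrite ll lm.
move=> [x y]; apply: cvg_pair.
  by apply: (cvg_comp fst l) (cl _); exact: cvg_fst.
by apply: (cvg_comp snd m) (cm _); exact: cvg_snd.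
Qed.

Lemma linear_cont_snd E F G (l : E -> F) : linear_cont l -> linear_cont (fun p : G * E => l p.2).
Proof.
move=> [ll cl]; split; first by move=> a [x x'] [y y'] /=; rewrite ll.
by move=> [x y]; apply: (cvg_comp snd l) (cl _); exact: cvg_snd.
Qed.

Lemma linear_cont_fst E F G (l : E -> F) : linear_cont l -> linear_cont (fun p : E * G => l p.1).
Proof.
move=> [ll cl]; split; first by move=> a [x x'] [y y'] /=; rewrite ll.
by move=> [x y]; apply: (cvg_comp fst l) (cl _); exact: cvg_fst.
Qed.

Lemma linear_cont_id E : linear_cont (@id E).
Proof. by split=> // x; exact: cvg_id. Qed.

Lemma Cn_on_lin n E F (lE : lctvs E) (lF : lctvs F) (U : set E) (l : E -> F) :
  open U -> linear_cont l -> Cn_on n U l.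
Proof.
elim: n E lE U l => [|n IHn] E lE U l oU ll.
  by split=> //; apply: cont_on_continuous; exact: ll.2.
apply: (Cn_onS lE lF oU _ (deriv_on_lin ll)); first by apply: cont_on_continuous; exact: ll.2.
by apply: IHn; [exact: open_setX oU openT|exact: linear_cont_snd].
Qed.

Lemma Cn_on_lincomp n E F G (lE : lctvs E) (lF : lctvs F) (lG : lctvs G)
  (U : set F) (V : set E) (g : F -> G) (l : E -> F) : open V ->
  linear_cont l -> Cn_on n U g -> (forall x, V x -> U (l x)) -> Cn_on n V (g \o l).
Proof.
elim: n E lE F lF U V g l => [|n IHn] E lE F lF U V g l oV ll [cg].
  by split=> //; apply: cont_on_comp cg _ _ => //; apply: cont_on_continuous; exact: ll.2.
move=> [dg cdg] VU.
have dgl : deriv_on V (g \o l) (fun p => dd g (l p.1, l p.2)).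
  by move=> x h /VU Ux; exact: (deriv_on_lincomp ll dg).
apply: (Cn_onS lE lG oV _ dgl).
  by apply: cont_on_comp cg _ _ => //; apply: cont_on_continuous; exact: ll.2.
apply: (IHn _ _ _ _ (U `*` setT) _ (dd g) (fun p => (l p.1, l p.2))) => //.
- exact: open_setX oV openT.
- exact: linear_cont_pair.
- by move=> [x h] [/= /VU].
Qed.

Lemma Cn_on_pair n E F G (lE : lctvs E) (lF : lctvs F) (lG : lctvs G) (U : set E)
  (f : E -> F) (g : E -> G) : open U -> Cn_on n U f -> Cn_on n U g ->
  Cn_on n U (fun x => (f x, g x)).
Proof.
elim: n E lE U f g => [|n IHn] E lE U f g oU [cf +] [cg].
  by split=> //; exact: cont_on_pair.
move=> [df cdf] [dg cdg]; apply: (Cn_onS lE _ oU _ (deriv_on_pair df dg)); first exact: cont_on_pair.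
by apply: IHn => //; exact: open_setX oU openT.
Qed.

(** The differential of f o g is dd f o (g o fst, dd g), a composition of maps of
one order less. *)
Lemma Cn_on_comp n E F G (lE : lctvs E) (lF : lctvs F) (lG : lctvs G)
  (U : set E) (V : set F) (f : F -> G) (g : E -> F) : open U -> open V ->
  Cn_on n V f -> Cn_on n U g -> (forall x, U x -> V (g x)) -> Cn_on n U (f \o g).
Proof.
elim: n E lE F lF U V f g => [|n IHn] E lE F lF U V f g oU oV [cf +] [cg] /=.
  by split=> //; exact: cont_on_comp cf cg _.
move=> [df cdf] [dg cdg] UV.
have cnW : Cn_on n U g by apply: Cn_on_W; split.
apply: (Cn_onS lE lG oU _ (deriv_on_comp lE lF lG oV df (Cn_on_cont cdf) dg UV)).
  exact: cont_on_comp cf cg _.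
have oUT : open (U `*` [set: E] : set (E * E)) by exact: open_setX oU openT.
apply: (IHn _ _ _ _ (U `*` setT) (V `*` setT) (dd f) (fun p => (g p.1, dd g p))) => //.
- exact: open_setX oV openT.
- apply: Cn_on_pair => //; apply: Cn_on_lincomp cnW _ => //.
    exact: linear_cont_fst (linear_cont_id _).
  by move=> [x h] [].
- by move=> [x h] [/= /UV].
Qed.

Lemma linear_cont_lincomb E (lE : lctvs E) (a : R) : linear_cont (fun p : E * E => a *: p.1 + p.2).
Proof.
split=> [b [x x'] [y y']|[x y]] /=.
  by rewrite !scalerDr !scalerA [b * a]mulrC !addrA; congr (_ + _); rewrite addrAC.
by apply: lcvgD; [apply: lcvgZr; exact: cvg_fst|exact: cvg_snd].
Qed.

Lemma deriv_on_lincomb E F (lF : lctvs F) (U : set E) (f g : E -> F) f' g'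
  (a : R) : deriv_on U f f' -> deriv_on U g g' ->
  deriv_on U (fun x => a *: f x + g x) (fun p => a *: f' p + g' p).
Proof.
move=> df dg x h Ux; rewrite (_ : diffq _ _ _ = fun t => a *: diffq f x h t + diffq g x h t).
  by apply: lcvgD; [apply: lcvgZr; exact: df|exact: dg].
apply/funext => t; rewrite /diffq scalerA [a * _]mulrC -scalerA -scalerDr.
by rewrite [a *: (_ - _)]scalerBr opprD addrACA.
Qed.

Lemma Cn_on_lincomb n E F (lE : lctvs E) (lF : lctvs F) (U : set E) (f g : E -> F)
  (a : R) : open U -> Cn_on n U f -> Cn_on n U g -> Cn_on n U (fun x => a *: f x + g x).
Proof.
move=> oU cf cg.
apply: (@Cn_on_comp _ _ _ _ _ _ _ U setT (fun p => a *: p.1 + p.2) (fun x => (f x, g x))) => //.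
- exact: openT.
- by apply: Cn_on_lin; [exact: openT|exact: linear_cont_lincomb].
- exact: Cn_on_pair.
Qed.

Lemma is_C1_deriv_on E F (lE : lctvs E) (lF : lctvs F) (U : set E) (f : E -> F) : open U ->
  is_C1 U f <-> [/\ cont_on U f, deriv_on U f (dd f) & cont_on (U `*` setT) (dd f)].
Proof.
move=> oU; have oUT : open (U `*` [set: E] : set (E * E)) by exact: open_setX oU openT.
split=> -[].
  move=> /(cont_onP _ oU) cf df /(cont_onP _ oUT) cdf; split=> // x h Ux.
  by have [l fl] := df x h Ux; rewrite (dd_eq lF fl).
move=> /(cont_onP _ oU) cf df /(cont_onP _ oUT) cdf; split=> // x h Ux.
by exists (dd f (x, h)); exact: df.
Qed.

Lemma is_C0_cont_on E F (U : set E) (f : E -> F) : open U -> is_C0 U f <-> cont_on U f.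
Proof. by move=> oU; rewrite cont_onP. Qed.

Section Iterate.
Variable F : preTopologicalLmodType R.

Let local := {E : preTopologicalLmodType R & (set E * (E -> F))%type}.
Let mk E (U : set E) (f : E -> F) : local := existT _ E (U, f).
Let step (p : local) : local := mk ((projT2 p).1 `*` setT) (dd (projT2 p).2).
Let C1 (p : local) := is_C1 (projT2 p).1 (projT2 p).2.

Let iterE j E (U : set E) (f : E -> F) :
  iter j step (mk U f) = mk (pow2_dom j U) (dn j f).
Proof. by elim: j => //= j ->. Qed.

Let is_CnE n E (U : set E) (f : E -> F) :
  is_Cn n U f <-> is_C0 U f /\ forall j, (j < n)%N -> C1 (iter j step (mk U f)).
Proof.
elim: n => [|n IHn] /=; first by split=> [|[]].
rewrite IHn; split=> [[[f0 fj] fn]|[f0 fj]].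
  split=> // j; rewrite ltnS leq_eqVlt => /orP[/eqP->|/fj//].
  by rewrite iterE.
split; last by have := fj n; rewrite iterE; exact.
by split=> // j jn; apply: fj; exact: ltnW.
Qed.

(** Both notions say that the first iterates of the step (E, U, f) |-> (E x E, U x E, dd f) are
of class C^1, but they unfold the iteration from opposite ends.  Iterating on
triples makes the types pow2 n (E x E) and pow2 n.+1 E meet without casts. *)
Lemma is_Cn_Cn_on n E (lE : lctvs E) (lF : lctvs F) (U : set E) (f : E -> F) : open U ->
  is_Cn n U f <-> Cn_on n U f.
Proof.
move=> oU; rewrite is_CnE; elim: n E lE U f oU => [|n IHn] E lE U f oU /=.
  by rewrite is_C0_cont_on//; split=> -[].
have oUT : open (U `*` [set: E] : set (E * E)) by exact: open_setX oU openT.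
rewrite is_C0_cont_on// -(IHn _ _ _ _ oUT) is_C0_cont_on//; split.
  move=> [cf fj]; have /(is_C1_deriv_on _ _ _ oU)[_ df cdf] := fj 0 isT.
  split=> //; split=> //; split=> // j jn.
  by have := fj j.+1 jn; rewrite iterSr.
move=> [cf [df [cdf fj]]]; split=> // -[_|j jn]; first exact/is_C1_deriv_on.
by rewrite iterSr; exact: fj.
Qed.

End Iterate.

End Calculus.

(** * Continuous convergence of families of maps *)

Lemma cvg_filter_prod T U V (F : set_system T) (G : set_system U) (H : set_system V)
  {FF : Filter F} {FG : Filter G} {FH : Filter H} (f : T -> U) (g : T -> V) :
  f @ F --> G -> g @ F --> H -> (fun x => (f x, g x)) @ F --> filter_prod G H.
Proof. exact: cvg_pair. Qed.

Lemma cvg_within_fmap T U (F : set_system T) {FF : Filter F} (D : set T) (f : T -> U)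
  (H : set_system U) : f @ F --> H -> f @ within D F --> H.
Proof.
move=> fF A HA; have := cvg_preimage_mem fF HA.
by apply: filterS => x Ax Dx.
Qed.

Lemma cvg_to_within T U (F : set_system T) {FF : Filter F} (D : set U) (f : T -> U)
  (H : set_system U) : F (f @^-1` D) -> f @ F --> H -> f @ F --> within D H.
Proof.
move=> FD fF A; rewrite /within /= => HA.
have := cvg_preimage_mem fF HA; apply: filterS2 FD => x Dx; exact.
Qed.

Lemma shift_cvg (R : realType) T (G : set_system T) {FG : Filter G} (c : T -> R) (t0 : R) :
  c @ G --> (0 : R) -> (fun x => t0 + c x) @ G --> nbhs t0.
Proof.
move=> c0; have L : (fun x => t0 + c x) @ G --> t0 + 0.
  by apply: cvgD c0; exact: cvg_cst.
by rewrite addr0 in L.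
Qed.

Section ContinuousConvergence.

(** Continuous convergence: g t x tends to g0 v when t runs along G and x tends
to v inside K.  With b = true the sets K are the compact subsets of U, which
gives compact-open convergence; with b = false all subsets are allowed, which
for open U, G = nbhs t0 and g0 = g t0 is joint continuity on {t0} x U.  One
development thus serves both for the topology of C^r(X, E) and for the
dependence on a real parameter. *)
Definition cconv (b : bool) T (G : set_system T) (S Z : topologicalType)
    (U : set S) (g : T -> S -> Z) (g0 : S -> Z) :=
  forall K : set S, (b -> compact K) -> K `<=` U -> forall v, K v ->
    (fun p : T * S => g p.1 p.2) @ filter_prod G (within K (nbhs v)) --> g0 v.

Context {b : bool} {T : Type} {G : set_system T} {FG : Filter G}.
Implicit Types S Z : topologicalType.

Lemma cconv_weak S Z (U : set S) (g : T -> S -> Z) (g0 : S -> Z) :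
  cconv false G U g g0 -> cconv b G U g g0.
Proof. by move=> gg0 K _; exact: gg0. Qed.

Lemma cconv_ext S Z (U : set S) (g h : T -> S -> Z) (g0 h0 : S -> Z) :
  (forall t x, U x -> g t x = h t x) -> (forall x, U x -> g0 x = h0 x) ->
  cconv b G U g g0 -> cconv b G U h h0.
Proof.
move=> gh gh0 gg0 K cK KU v Kv; rewrite -gh0; last exact: KU.
apply: cvg_trans (gg0 K cK KU v Kv); apply: near_eq_cvg.
exists (setT, K); first by split; [exact: filterT|exact: withinT].
by move=> [t x] [/= _ /KU /gh].
Qed.

(** The class of admissible sets K is stable under continuous images. *)
Lemma cconv_precomp S S' Z (U : set S) (V : set S') (l : S' -> S)
  (g : T -> S -> Z) (g0 : S -> Z) : cont_on V l -> (forall x, V x -> U (l x)) ->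
  cconv b G U g g0 -> cconv b G V (fun t => g t \o l) (g0 \o l).
Proof.
move=> cl VU gg0 K cK KV v Kv.
have wl x : K x -> l @ within K (nbhs x) --> within (l @` K) (nbhs (l x)).
  move=> Kx A; rewrite /within /= => lA.
  have := cvg_preimage_mem (cl x (KV x Kx)) lA.
  by rewrite /within /=; apply: filterS => y Ay Ky; apply: Ay; exists y.
apply: (@cvg_comp _ _ _ (fun p => (p.1, l p.2)) (fun p => g p.1 p.2) _
  (filter_prod G (within (l @` K) (nbhs (l v))))).
  apply: cvg_filter_prod; first exact: cvg_fst.
  by apply: (@cvg_comp _ _ _ snd l _ (within K (nbhs v))); [exact: cvg_snd|exact: wl].
apply: gg0; last by exists v.
- move=> /cK; apply: continuous_compact; apply/subspace_continuousP => x Kx.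
  by apply: cvg_within_fmap; exact: (cl x (KV x Kx)).
- by move=> _ [x /KV /VU Ux <-].
Qed.

Lemma cconv_comp S Z Z' (U : set S) (V : set Z) (f : Z -> Z')
  (g : T -> S -> Z) (g0 : S -> Z) : cont_on V f -> (forall x, U x -> V (g0 x)) ->
  cconv b G U g g0 -> cconv b G U (fun t => f \o g t) (f \o g0).
Proof.
move=> cf UV gg0 K cK KU v Kv.
exact: cvg_comp (gg0 K cK KU v Kv) (cf _ (UV _ (KU _ Kv))).
Qed.

Lemma cconv_pair S Z Z' (U : set S) (g : T -> S -> Z) (g0 : S -> Z)
  (h : T -> S -> Z') (h0 : S -> Z') :
  cconv b G U g g0 -> cconv b G U h h0 ->
  cconv b G U (fun t x => (g t x, h t x)) (fun x => (g0 x, h0 x)).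
Proof. by move=> cg ch K cK KU v Kv; apply: cvg_pair; [exact: cg|exact: ch]. Qed.

Lemma cconv_cst S Z (U : set S) (g : S -> Z) : cont_on U g ->
  cconv b G U (fun=> g) g.
Proof.
move=> cg K cK KU v Kv.
apply: (@cvg_comp _ _ _ snd g _ (within K (nbhs v))); first exact: cvg_snd.
by apply: cvg_within_fmap; exact: (cg v (KU v Kv)).
Qed.

End ContinuousConvergence.

(** * Convergence of families together with their iterated differentials *)

Section JetConvergence.
Context {R : realType}.
Implicit Types E F : preTopologicalLmodType R.

(** By iteration the differentials of order at most n of g t converge to those
of g0. *)
Fixpoint jet_conv (b : bool) T (G : set_system T) (n : nat) E F (U : set E)
    (g : T -> E -> F) (g0 : E -> F) : Prop :=
  cconv b G U g g0 /\
  if n is m.+1 then @jet_conv b T G m (E * E)%type F (U `*` setT)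
    (fun t => dd (g t)) (dd g0) else True.

Lemma jet_conv_cconv b T (G : set_system T) n E F (U : set E) (g : T -> E -> F) g0 :
  jet_conv b G n U g g0 -> cconv b G U g g0.
Proof. by case: n => [|n] []. Qed.

Lemma dd_lincomp n E E' F (lE : lctvs E) (lE' : lctvs E') (lF : lctvs F)
  (U : set E) (g : E -> F) (l : E' -> E) : linear_cont l -> Cn_on n.+1 U g ->
  forall p, U (l p.1) -> dd (g \o l) p = dd g (l p.1, l p.2).
Proof.
move=> ll [_ [dg _]]; exact: deriv_on_dd (deriv_on_lincomp ll dg).
Qed.

Lemma dd_pair n E F F' (lF : lctvs F) (lF' : lctvs F') (U : set E)
  (f : E -> F) (g : E -> F') : Cn_on n.+1 U f -> Cn_on n.+1 U g ->
  forall p, U p.1 -> dd (fun x => (f x, g x)) p = (dd f p, dd g p).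
Proof. move=> [_ [df _]] [_ [dg _]]; exact: deriv_on_dd (deriv_on_pair df dg). Qed.

Lemma dd_comp n E F F' (lE : lctvs E) (lF : lctvs F) (lF' : lctvs F') (U : set E)
  (V : set F) (f : F -> F') (g : E -> F) : open V -> Cn_on n.+1 V f -> Cn_on n.+1 U g ->
  (forall x, U x -> V (g x)) ->
  forall p, U p.1 -> dd (f \o g) p = dd f (g p.1, dd g p).
Proof.
move=> oV [_ [df cdf]] [_ [dg _]] UV.
exact: deriv_on_dd (deriv_on_comp lE lF lF' oV df (Cn_on_cont cdf) dg UV).
Qed.

Section Fixed.
Context {b : bool} {T : Type} {G : set_system T} {FG : Filter G}.

Lemma jet_conv_weak n E F (U : set E) (g : T -> E -> F) (g0 : E -> F) :
  jet_conv false G n U g g0 -> jet_conv b G n U g g0.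
Proof.
elim: n E U g g0 => [|n IHn] E U g g0 /= [gg0 dg]; split=> //; try exact: cconv_weak.
exact: IHn.
Qed.

Lemma jet_conv_ext n E F (lE : lctvs E) (U : set E) (g h : T -> E -> F)
  (g0 h0 : E -> F) : open U ->
  (forall t x, U x -> g t x = h t x) -> (forall x, U x -> g0 x = h0 x) ->
  jet_conv b G n U g g0 -> jet_conv b G n U h h0.
Proof.
elim: n E lE U g h g0 h0 => [|n IHn] E lE U g h g0 h0 oU gh gh0 /= [gg0 dg].
  by split=> //; exact: cconv_ext gg0.
split; first exact: cconv_ext gg0.
apply: IHn dg; first exact: open_setX oU openT.
  by move=> t p [Up _]; exact: (dd_ext lE oU (gh t)).
by move=> p [Up _]; exact: (dd_ext lE oU gh0).
Qed.

Lemma jet_conv_lincomp n E E' F (lE : lctvs E) (lE' : lctvs E') (lF : lctvs F)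
  (U : set E) (V : set E') (l : E' -> E) (g : T -> E -> F) (g0 : E -> F) :
  open V -> linear_cont l -> (forall x, V x -> U (l x)) ->
  (forall t, Cn_on n U (g t)) -> Cn_on n U g0 ->
  jet_conv b G n U g g0 -> jet_conv b G n V (fun t => g t \o l) (g0 \o l).
Proof.
elim: n E lE E' lE' U V l g g0 => [|n IHn] E lE E' lE' U V l g g0 oV ll VU cg cg0 /= [gg0 dg].
  by split=> //; apply: cconv_precomp gg0 => //; apply: cont_on_continuous; exact: ll.2.
split; first by apply: cconv_precomp gg0 => //; apply: cont_on_continuous; exact: ll.2.
have oVT : open (V `*` [set: E'] : set (E' * E')) by exact: open_setX oV openT.
apply: (@jet_conv_ext _ _ _ _ _ (fun t => dd (g t) \o (fun p => (l p.1, l p.2))) _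
  (dd g0 \o (fun p => (l p.1, l p.2)))) => //.
- by move=> t p [/= /VU Up _]; rewrite (dd_lincomp lE lE' lF ll (cg t)).
- by move=> p [/= /VU Up _]; rewrite (dd_lincomp lE lE' lF ll cg0).
- apply: IHn dg => //; first exact: linear_cont_pair.
  + by move=> p [/= /VU].
  + by move=> t; have [_ []] := cg t.
  + by have [_ []] := cg0.
Qed.

Lemma jet_conv_pair n E F F' (lE : lctvs E) (lF : lctvs F) (lF' : lctvs F')
  (U : set E) (g : T -> E -> F) (g0 : E -> F) (h : T -> E -> F') (h0 : E -> F') :
  open U -> (forall t, Cn_on n U (g t)) -> Cn_on n U g0 ->
  (forall t, Cn_on n U (h t)) -> Cn_on n U h0 ->
  jet_conv b G n U g g0 -> jet_conv b G n U h h0 ->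
  jet_conv b G n U (fun t x => (g t x, h t x)) (fun x => (g0 x, h0 x)).
Proof.
elim: n E lE U g g0 h h0 => [|n IHn] E lE U g g0 h h0 oU cg cg0 ch ch0 /= [gg0 dg] [hh0 dh].
  by split=> //; exact: cconv_pair.
split; first exact: cconv_pair.
have oUT : open (U `*` [set: E] : set (E * E)) by exact: open_setX oU openT.
apply: (@jet_conv_ext _ _ _ _ _ (fun t p => (dd (g t) p, dd (h t) p)) _
  (fun p => (dd g0 p, dd h0 p))) => //.
- by move=> t p [Up _]; rewrite (dd_pair lF lF' (cg t) (ch t)).
- by move=> p [Up _]; rewrite (dd_pair lF lF' cg0 ch0).
- apply: IHn => //.
  + by move=> t; have [_ []] := cg t.
  + by have [_ []] := cg0.
  + by move=> t; have [_ []] := ch t.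
  + by have [_ []] := ch0.
Qed.

Lemma jet_conv_cst n E F (U : set E) (g : E -> F) : Cn_on n U g ->
  jet_conv b G n U (fun=> g) g.
Proof.
elim: n E U g => [|n IHn] E U g [cg]; first by split=> //; exact: cconv_cst.
by move=> [_ dg]; split; [exact: cconv_cst|exact: IHn].
Qed.

Lemma jet_conv_W n E F (U : set E) (g : T -> E -> F) (g0 : E -> F) :
  jet_conv b G n.+1 U g g0 -> jet_conv b G n U g g0.
Proof.
elim: n E U g g0 => [|n IHn] E U g g0; first by move=> [gg0 _]; split.
by move=> [gg0 dg]; split=> //; exact: IHn.
Qed.

(** Induction on the order with the chain rule: the differentials dd f o
(g t o fst, dd (g t)) have the same form, and their inner maps converge to
one order less. *)
Lemma jet_conv_comp n E F F' (lE : lctvs E) (lF : lctvs F) (lF' : lctvs F')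
  (U : set E) (V : set F) (f : F -> F') (g : T -> E -> F) (g0 : E -> F) :
  open U -> open V -> Cn_on n V f -> (forall t, Cn_on n U (g t)) -> Cn_on n U g0 ->
  (forall t x, U x -> V (g t x)) -> (forall x, U x -> V (g0 x)) ->
  jet_conv b G n U g g0 -> jet_conv b G n U (fun t => f \o g t) (f \o g0).
Proof.
elim: n E lE F lF U V f g g0 => [|n IHn] E lE F lF U V f g g0 oU oV cf cg cg0 UV UV0 gg0.
  by split=> //; apply: cconv_comp (Cn_on_cont cf) UV0 gg0.1.
split; first by apply: cconv_comp (Cn_on_cont cf) UV0 gg0.1.
have oUT : open (U `*` [set: E] : set (E * E)) by exact: open_setX oU openT.
have lfst : linear_cont (fst : E * E -> E) by exact: linear_cont_fst (linear_cont_id _).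
have UU (x : E * E) : (U `*` setT) x -> U x.1 by case.
apply: (@jet_conv_ext _ _ _ _ _ (fun t => dd f \o (fun p => (g t p.1, dd (g t) p))) _
  (dd f \o (fun p => (g0 p.1, dd g0 p)))) => //.
- by move=> t p [Up _]; rewrite (dd_comp lE lF lF' oV cf (cg t) (UV t)).
- by move=> p [Up _]; rewrite (dd_comp lE lF lF' oV cf cg0 UV0).
have cgf t : Cn_on n (U `*` setT) (g t \o (fst : E * E -> E)).
  exact: (Cn_on_lincomp _ _ _ oUT lfst (Cn_on_W (cg t)) UU).
have cg0f : Cn_on n (U `*` setT) (g0 \o (fst : E * E -> E)).
  exact: (Cn_on_lincomp _ _ _ oUT lfst (Cn_on_W cg0) UU).
have cdg t : Cn_on n (U `*` setT) (dd (g t)) by have [_ []] := cg t.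
have cdg0 : Cn_on n (U `*` setT) (dd g0) by have [_ []] := cg0.
apply: (IHn _ _ _ _ (U `*` setT) (V `*` setT) (dd f)
  (fun t p => (g t p.1, dd (g t) p)) (fun p => (g0 p.1, dd g0 p))) => //.
- exact: open_setX oV openT.
- by have [_ []] := cf.
- by move=> t; exact: (Cn_on_pair _ _ _ oUT (cgf t) (cdg t)).
- exact: (Cn_on_pair _ _ _ oUT cg0f cdg0).
- by move=> t [x y] [/= /UV].
- by move=> [x y] [/= /UV0].
- apply: jet_conv_pair => //; last exact: gg0.2.
  exact: (jet_conv_lincomp lE _ lF oUT lfst UU (fun t => Cn_on_W (cg t)) (Cn_on_W cg0) (jet_conv_W gg0)).
Qed.

End Fixed.

(** * Interchanging differentiation in a parameter and in the argument *)

Section Curves.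
Variable F : preTopologicalLmodType R.
Hypothesis lF : lctvs F.

Lemma curve_deriv_scale (phi : R -> F) (a c s : R) (l : F) : c != 0 ->
  curve_deriv phi (a + s * c) l -> curve_deriv (fun s => c^-1 *: phi (a + s * c)) s l.
Proof.
move=> c0 dphi; rewrite /curve_deriv.
rewrite (_ : (fun h : R => _) = (fun h => h^-1 *: (phi (a + s * c + h) - phi (a + s * c)))
    \o (fun h => h * c)); last first.
  apply/funext => h /=; rewrite -scalerBr scalerA -invfM.
  by rewrite mulrDl addrA.
by apply: cvg_comp (scale_dnbhs c0) _; exact: dphi.
Qed.

Lemma curve_derivZB (a : R) (phi psi : R -> F) (t : R) (l m : F) :
  curve_deriv phi t l -> curve_deriv psi t m ->
  curve_deriv (fun t => a *: (phi t - psi t)) t (a *: (l - m)).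
Proof.
move=> dphi dpsi; rewrite /curve_deriv.
rewrite (_ : (fun h : R => _) = fun h : R => a *: (h^-1 *: (phi (t + h) - phi t) -
  h^-1 *: (psi (t + h) - psi t))); last first.
  apply/funext => h; rewrite -!scalerBr scalerA mulrC -scalerA; congr (_ *: (_ *: _)).
  by rewrite !opprD !opprK addrACA.
by apply: lcvgZr; exact: lcvgB.
Qed.

(** The difference quotient of h is the increment over [0, 1] of
s |-> h (t0 + s t) x / t, with derivative k (t0 + s t) x, which is close to
k t0 v uniformly in s by joint continuity. *)
Lemma cconv_quot (S : topologicalType) (U : set S) (h k : R -> S -> F) :
  (forall t x, U x -> curve_deriv (h^~ x) t (k t x)) ->
  (forall t0, cconv false (nbhs t0) U k (k t0)) ->
  forall t0, cconv false (0 : R)^' U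
    (fun t x => t^-1 *: (h (t0 + t) x - h t0 x)) (k t0).
Proof.
move=> dh ck t0 K cK KU v Kv.
have L : (fun p : R * S => p.1^-1 *: h (t0 + 1 * p.1) p.2 -
    p.1^-1 *: h (t0 + 0 * p.1) p.2)
    @ filter_prod (0 : R)^' (within K (nbhs v)) --> k t0 v.
  apply: (@mvt_cvg R F lF _ _ _ _ (fun p s => p.1^-1 *: h (t0 + s * p.1) p.2)
    (fun p s => k (t0 + s * p.1) p.2)).
    have n0 : \forall t \near (0 : R)^', t != 0 by exact: nbhs_dnbhs_neq.
    exists ([set t | t != 0], K); first by split; [exact: n0|exact: withinT].
    move=> [t x] [/= tn /KU Ux] s s01.
    by apply: (curve_deriv_scale (phi := h^~ x)) => //; exact: (dh (t0 + s * t) x).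
  move=> W cW.
  have c0 : (fst : R * S -> R) @ filter_prod (0 : R)^' (within K (nbhs v)) --> (0 : R).
    by apply: cvg_trans (@cvg_fst _ _ _ _ _) _; exact: nbhs_dnbhs.
  apply: (near_segment (psi := fun p => k (t0 + p.1) p.2) c0 cvg_snd _ cW).
  apply: (@cvg_comp _ _ _ (fun p => (t0 + p.1, p.2)) (fun p => k p.1 p.2) _
    (filter_prod (nbhs t0) (within K (nbhs v)))); last exact: ck.
  apply: cvg_filter_prod; last exact: cvg_snd.
  by apply: shift_cvg; exact: cvg_fst.
apply: cvg_trans L; apply: near_eq_cvg; apply: filterE => -[t x] /=.
by rewrite mul1r mul0r addr0 scalerBr.
Qed.

(** The double difference quotient of h in t and y is close to dd (k t0) (y, w), by
the mean value theorem first in t and then along w.  Letting the increment along w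
tend to 0 inside a closed neighbourhood gives the difference quotient in t of dd h. *)
Lemma schwarz E (lE : lctvs E) (U : set E) (h k : R -> E -> F) : open U ->
  (forall t, deriv_on U (h t) (dd (h t))) -> (forall t, deriv_on U (k t) (dd (k t))) ->
  (forall t x, U x -> curve_deriv (h^~ x) t (k t x)) ->
  (forall t0, cconv false (nbhs t0) (U `*` setT) (fun t => dd (k t)) (dd (k t0))) ->
  forall t p, U p.1 -> curve_deriv (fun t => dd (h t) p) t (dd (k t) p).
Proof.
move=> oU dh dk hk ck t0 [y w] /= Uy W0 cW0.
have [W [cW clW WW0]] := lctvs_regular lF cW0.
suff : \forall t \near (0 : R)^', W (t^-1 *: (dd (h (t0 + t)) (y, w) - dd (h t0) (y, w))).
  by apply: filterS => t; exact: WW0.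
(* W1 controls the increments in t and W2 those along w. *)
have [W1 cW1 W1W] := mvt_nbhs lF cW.
have [W2 cW2 W2W1] := mvt_nbhs lF cW1.
have oUT : open (U `*` [set: E] : set (E * E)) by exact: open_setX oU openT.
have Ly : (fun p : R * R => y + p.2 *: w) @ (0 : R, 0 : R) --> y.
  rewrite -[X in _ --> X]addr0 -(scale0r w); apply: lcvgD; first exact: cvg_cst.
  by apply: lcvgZ; [exact: cvg_snd|exact: cvg_cst].
have JU : \forall p \near (0 : R, 0 : R), U (y + p.2 *: w).
  by apply: Ly; exact: open_nbhs_nbhs.
have J : (fun p : R * R => dd (k (t0 + p.1)) (y + p.2 *: w, w)) @ (0 : R, 0 : R)
    --> dd (k t0) (y, w).
  have := ck t0 (U `*` setT) (fun h => False_ind _ (notF h)) (fun=> id) (y, w) (conj Uy I).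
  apply: (@cvg_comp _ _ _ (fun p : R * R => (t0 + p.1, (y + p.2 *: w, w)))
    (fun p => dd (k p.1) p.2)).
  apply: cvg_filter_prod.
    by apply: shift_cvg; exact: cvg_fst.
  apply: cvg_to_within; first by apply: filterS JU => p.
  by apply: cvg_pair; [exact: Ly|exact: cvg_cst].
have [[/= A B] [/nbhs_ballP[a /= a0 aA] /nbhs_ballP[b /= b0 bB]] AB] :=
  filterI (cvg_preimage_mem J cW2) JU.
have := dnbhs_ball (0 : R) a0; apply: filterS => t [ta tn].
have tn0 : t != 0 by apply/eqP.
have lim : (fun s => t^-1 *: (diffq (h (t0 + t)) y w s - diffq (h t0) y w s)) @ (0 : R)^'
    --> t^-1 *: (dd (h (t0 + t)) (y, w) - dd (h t0) (y, w)).
  by apply: lcvgZr; apply: lcvgB; exact: dh.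
apply: (@closed_cvg R F (0 : R)^' _ _ W clW _ _ lim).
have := dnbhs_ball (0 : R) b0; apply: filterS => s [sb sn].
have sn0 : s != 0 by apply/eqP.
have inb (c r q : R) : 0 <= r <= 1 -> ball 0 c q -> ball 0 c (r * q).
  move=> /andP[r0 r1]; rewrite /ball /= !sub0r !normrN normrM ger0_norm// => qc.
  by apply: le_lt_trans qc; rewrite ler_piMl.
have := W1W (fun r => t^-1 *: (s^-1 *: (h (t0 + r * t) (y + s *: w) - h (t0 + r * t) y)))
  (fun r => s^-1 *: (k (t0 + r * t) (y + s *: w) - k (t0 + r * t) y)).
rewrite mul1r mul0r addr0 -scalerBr; apply=> r r01.
  apply: (curve_deriv_scale (phi := fun r => s^-1 *: (h r (y + s *: w) - h r y))) => //.
  apply: curve_derivZB; apply: hk => //.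
  have [] := AB (0, s) => //; split=> /=; last exact: bB.
  by apply: aA; exact: ballxx.
have := W2W1 (fun q => s^-1 *: k (t0 + r * t) (y + (q * s) *: w))
  (fun q => dd (k (t0 + r * t)) (y + (q * s) *: w, w)).
rewrite mul1r mul0r scale0r addr0 -scalerBr; apply=> q q01.
  apply: (curve_deriv_line sn0 (dk (t0 + r * t))).
  have [] // := AB (0, q * s); split=> /=; first by apply: aA; exact: ballxx.
  by apply: bB; exact: inb.
have [] // := AB (r * t, q * s); split=> /=; first by apply: aA; exact: inb.
by apply: bB; exact: inb.
Qed.

(** By [schwarz] the pair (dd h, dd k) satisfies the same assumptions as
(h, k), so that [cconv_quot] applies at each order. *)
Lemma jet_conv_quot n E (lE : lctvs E) (U : set E) (h k : R -> E -> F) : open U ->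
  (forall t, Cn_on n U (h t)) -> (forall t, Cn_on n U (k t)) ->
  (forall t x, U x -> curve_deriv (h^~ x) t (k t x)) ->
  (forall t0, jet_conv false (nbhs t0) n U k (k t0)) ->
  forall t0, jet_conv false (0 : R)^' n U
    (fun t x => t^-1 *: (h (t0 + t) x - h t0 x)) (k t0).
Proof.
elim: n E lE U h k => [|n IHn] E lE U h k oU ch ck hk fk t0.
  by split=> //; apply: cconv_quot => // t; have [] := fk t.
split; first by apply: cconv_quot => // t; have [] := fk t.
have oUT : open (U `*` [set: E] : set (E * E)) by exact: open_setX oU openT.
apply: (@jet_conv_ext _ _ _ _ _ _ _ _ _ (fun t p => t^-1 *: (dd (h (t0 + t)) p - dd (h t0) p))
  _ (dd (k t0))) => //.
  move=> t p [Up _]; symmetry.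
  have dht := (ch (t0 + t)).2.1; have dh0 := (ch t0).2.1.
  have dq : deriv_on U (fun x => t^-1 *: (h (t0 + t) x - h t0 x))
      (fun p => t^-1 *: (dd (h (t0 + t)) p - dd (h t0) p)).
    move=> x v Ux; rewrite (_ : diffq _ _ _ = fun s => t^-1 *:
      (diffq (h (t0 + t)) x v s - diffq (h t0) x v s)).
      by apply: lcvgZr; apply: lcvgB; [exact: dht|exact: dh0].
    apply/funext => s; rewrite /diffq -!scalerBr !scalerA [_^-1 * s^-1]mulrC; congr (_ *: _).
    by rewrite !opprD !opprK addrACA.
  exact: (deriv_on_dd lF dq).
apply: (IHn _ _ _ (fun t => dd (h t)) (fun t => dd (k t))) => //.
- by move=> t; exact: (ch t).2.2.
- by move=> t; exact: (ck t).2.2.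
- move=> t p [Up _]; apply: (schwarz lE oU) => //.
  + by move=> s; exact: (ch s).2.1.
  + by move=> s; exact: (ck s).2.1.
  + by move=> s; exact: (jet_conv_cconv (fk s).2).
- by move=> s; exact: (fk s).2.
Qed.

End Curves.
End JetConvergence.

(** * Charts and tangent bundles *)

Section Charts.
Context {R : realType}.
Implicit Types E M : preTopologicalLmodType R.

Lemma chart_invE M (X : chartedSpace M) (i : chart_idx X) (x : X) :
  {in chart_dom i &, injective (chart (c := X) i)} -> chart_dom i x ->
  chart_inv i (chart i x) = Some x.
Proof.
move=> inj ix; apply: xget_unique; first by exists x.
move=> _ [x' [ix' xx'] ->]; congr Some.
by apply: inj xx'; rewrite inE.
Qed.

Lemma in_chartE M (X : chartedSpace M) (E : lmodType R) (g : X -> E)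
  (i : chart_idx X) (x : X) :
  {in chart_dom i &, injective (chart (c := X) i)} -> chart_dom i x ->
  in_chart g i (chart i x) = g x.
Proof. by move=> inj ix; rewrite /in_chart chart_invE. Qed.

Lemma is_atlas_sub (r s : natinf) M (X : chartedSpace M) :
  (forall n, le_natinf n s -> le_natinf n r) -> is_atlas r X -> is_atlas s X.
Proof.
move=> sr [? ? ? ? ? ? tr]; split=> // i j n ns; exact/tr/sr.
Qed.

Section Atlas.
Context {M : preTopologicalLmodType R} {lM : lctvs M} {X : chartedSpace M}.
Context {r : natinf} (aX : is_atlas r X).
Implicit Types i j : chart_idx X.

Let inj i : {in chart_dom i &, injective (chart (c := X) i)}.
Proof. exact: chart_inj aX i. Qed.

Lemma chart_codP i y : chart_cod i y -> exists2 x, chart_dom i x & chart i x = y.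
Proof. by rewrite -(chart_image aX i). Qed.

Lemma chart_dom_cod i x : chart_dom i x -> chart_cod i (chart i x).
Proof. by move=> ix; rewrite -(chart_image aX i); exists x. Qed.

Lemma chart_cont_on i : cont_on (chart_dom i) (chart i).
Proof. by apply/cont_onP; [exact: chart_dom_open aX i|exact: chart_continuous aX i]. Qed.

Definition overlap i j : set M := chart i @` (chart_dom i `&` chart_dom j).

Lemma overlap_open i j : open (overlap i j).
Proof.
apply: (chart_open_map aX); last exact: subIsetl.
by apply: openI; exact: (chart_dom_open aX).
Qed.

Lemma overlapP i j x : chart_dom i x -> overlap i j (chart i x) <-> chart_dom j x.
Proof.
move=> ix; split=> [[x' [ix' jx'] xx']|jx]; last by exists x.
by rewrite -(inj _ _ xx') ?inE.
Qed.

Lemma in_chart_overlap E (g : X -> E) i j y : overlap i j y ->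
  in_chart g i y = in_chart g j (in_chart (chart j) i y).
Proof. by move=> [x [ix jx] <-]; rewrite !in_chartE. Qed.

Lemma transition_cod i j y : overlap i j y -> chart_cod j (in_chart (chart j) i y).
Proof. by move=> [x [ix jx] <-]; rewrite in_chartE//; exact: chart_dom_cod. Qed.

Lemma transition_Cn n i j : le_natinf n r -> Cn_on n (overlap i j) (in_chart (chart j) i).
Proof.
by move=> nr; apply/is_Cn_Cn_on; [exact: overlap_open|exact: chart_transition aX i j n nr].
Qed.

(** The chain rule for the chart change from i to j. *)
Lemma dd_in_chart E {lE : lctvs E} (g : X -> E) i j (x : X) (w : M) :
  le_natinf 1 r -> Cn_on 1 (chart_cod j) (in_chart g j) -> chart_dom i x -> chart_dom j x ->
  dd (in_chart g i) (chart i x, w) =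
  dd (in_chart g j) (chart j x, dd (in_chart (chart j) i) (chart i x, w)).
Proof.
move=> r1 cg ix jx.
have ov : overlap i j (chart i x) by exact/overlapP.
rewrite (dd_ext lM (overlap_open i j) (in_chart_overlap g (i := i) (j := j)))//.
rewrite (dd_comp lM lM lE (chart_cod_open j) cg (transition_Cn i j r1)
  (transition_cod (j := j) (i := i)))//=.
by rewrite in_chartE.
Qed.

End Atlas.

Section Tangent.
Context {M : preTopologicalLmodType R} {lM : lctvs M} {X : chartedSpace M}.
Context {r : natinf} (aX : is_atlas r X) (r1 : le_natinf 1 r).
Implicit Types (i j : chart_idx X) (p q : tangent X).

Let inj i : {in chart_dom i &, injective (chart (c := X) i)}.
Proof. exact: chart_inj aX i. Qed.

Lemma tangent_eq p q : foot p = foot q -> tvec p = tvec q -> p = q.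
Proof.
case: p q => [x v vo vc] [x' v' vo' vc'] /= xx vv; subst x' v'.
by congr Tangent; exact: Prop_irrelevance.
Qed.

Lemma tchart_inj i p q : chart_dom i (foot p) -> chart_dom i (foot q) ->
  tchart i p = tchart i q -> p = q.
Proof.
move=> ip iq [pq vpq].
have fpq : foot p = foot q by apply: inj pq; rewrite inE.
apply: tangent_eq => //; apply/funext => j.
have [jp|jp] := pselect (chart_dom j (foot p)).
  have jq : chart_dom j (foot q) by rewrite -fpq.
  by rewrite (tvec_compat ip jp) (tvec_compat iq jq) vpq pq.
by rewrite !tvec_out// -fpq.
Qed.

(** The components of the tangent vector in the other charts are forced
by the chart changes; their compatibility is the chain rule for a composition of
two chart changes. *)
Lemma tchart_surj i y w : chart_cod i y ->
  exists2 p, chart_dom i (foot p) & tchart i p = (y, w).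
Proof.
move=> /(chart_codP aX)[x ix xy].
pose v j : M := if pselect (chart_dom j x) is left _
  then dd (in_chart (chart j) i) (chart i x, w) else 0.
have vE j : chart_dom j x -> v j = dd (in_chart (chart j) i) (chart i x, w).
  by rewrite /v; case: pselect.
have vo j : ~ chart_dom j x -> v j = 0 by rewrite /v; case: pselect.
have vc j k : chart_dom j x -> chart_dom k x ->
    v k = dd (in_chart (chart k) j) (chart j x, v j).
  move=> jx kx; rewrite !vE//.
  have oij : overlap i j (chart i x) by exact/(overlapP aX).
  (* On O the chart change from i to k factors through the chart j. *)
  pose O := overlap i j `&` overlap i k.
  have oO : open O by apply: openI; exact: (overlap_open aX).
  have Ox : O (chart i x) by split; exact/(overlapP aX).
  have OE y' : O y' -> in_chart (chart k) i y' =
      (in_chart (chart k) j \o in_chart (chart j) i) y'.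
    by move=> [/(in_chart_overlap aX (chart k))].
  have OV y' : O y' -> overlap j k (in_chart (chart j) i y').
    move=> [[z [iz jz] <-] [z' [iz' kz'] zz']]; rewrite in_chartE//.
    apply/(overlapP aX) => //.
    by have <- : z' = z by apply: inj zz'; rewrite inE.
  rewrite (dd_ext lM oO OE)// (dd_comp lM lM lM (overlap_open aX j k)
    (transition_Cn aX j k r1) (Cn_on_sub _ (transition_Cn aX i j r1)) OV)//=.
    by rewrite in_chartE.
  exact: subIsetl.
(* The component in the chart i itself is w, since the chart change from i to i is the identity. *)
exists (Tangent vo vc) => //=; rewrite /tchart /= xy vE//; congr pair.
have idE y' : chart_cod i y' -> in_chart (chart i) i y' = id y'.
  by move=> /(chart_codP aX)[z iz <-]; rewrite in_chartE.
rewrite (dd_ext lM (chart_cod_open i) idE); last exact: chart_dom_cod aX _ _ ix.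
by rewrite (deriv_on_dd lM (deriv_on_lin (U := setT) (linear_cont_id M))).
Qed.

Lemma tangent_openE (A : set (tangent X)) : open A = tangent_open A.
Proof. by []. Qed.

Lemma foot_continuous : continuous (@foot R M X).
Proof.
apply/continuousP => A oA; rewrite tangent_openE => i.
have oAi : open (chart i @` (A `&` chart_dom i)).
  apply: (chart_open_map aX); last exact: subIsetr.
  by apply: openI oA _; exact: (chart_dom_open aX).
exists ((chart i @` (A `&` chart_dom i)) `*` setT); first exact: open_setX oAi openT.
move=> p ip; split=> [Ap|[/= [x [Ax ix] xp] _]]; first by split=> //; exists (foot p).
rewrite /preimage /=; have <- // : x = foot p by apply: inj xp; rewrite inE.
Qed.

Lemma tchart_dom_open i : open [set p : tangent X | chart_dom i (foot p)].
Proof.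
have /continuousP := foot_continuous.
by apply; exact: (chart_dom_open aX).
Qed.

Let Ttrans i j (p : M * M) : (M * M)%type :=
  (in_chart (chart j) i p.1, dd (in_chart (chart j) i) p).

Let Ttrans_Cn n i j : le_natinf n.+1 r -> Cn_on n (overlap i j `*` setT) (Ttrans i j).
Proof.
move=> nr; have cT : Cn_on n.+1 (overlap i j) (in_chart (chart j) i) by exact: (transition_Cn aX).
have oT : open (overlap i j `*` [set: M] : set (M * M)).
  exact: open_setX (overlap_open aX i j) openT.
apply: Cn_on_pair => //; last exact: cT.2.2.
apply: (@Cn_on_lincomp _ _ _ _ _ _ _ _ (overlap i j) _ _ fst) (Cn_on_W cT) _ => //.
  exact: linear_cont_fst (linear_cont_id _).
by move=> [x y] [].
Qed.

Let TtransE i j p : chart_dom i (foot p) -> chart_dom j (foot p) ->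
  tchart j p = Ttrans i j (tchart i p).
Proof. by move=> ip jp; rewrite /Ttrans /tchart /= in_chartE// (tvec_compat ip jp). Qed.

(** Read in the chart T(chart j) this set is a preimage under the
tangent map of the chart change from j to i, which is continuous. *)
Lemma tchart_open i (W : set (M * M)) : open W ->
  open ([set p : tangent X | chart_dom i (foot p) /\ W (tchart i p)]).
Proof.
move=> oW; rewrite tangent_openE => j.
exists ((overlap j i `*` setT) `&` Ttrans j i @^-1` W).
  apply: open_cont_on_preimage oW.
    exact: open_setX (overlap_open aX j i) openT.
  by apply: Cn_on_cont; exact: Ttrans_Cn r1.
move=> p jp; split=> [[ip Wp]|[[/= /(overlapP aX _ jp) ip _]]].
  split; first by split=> //=; exact/(overlapP aX).
  by rewrite /preimage /= -(TtransE jp ip).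
by rewrite /preimage /= -(TtransE jp ip).
Qed.

Lemma tchart_cont_on i : cont_on [set p : tangent X | chart_dom i (foot p)] (tchart i).
Proof.
move=> p ip W; rewrite /= nbhsE => -[W' [oW' W'p] W'W].
have : nbhs p [set p : tangent X | chart_dom i (foot p) /\ W' (tchart i p)].
  by apply: open_nbhs_nbhs; split=> //; exact: tchart_open.
by apply: filterS => q [_ /W'W].
Qed.

(** The chart changes of the tangent bundle are the tangent maps of those
of X. *)
Lemma tangent_atlas (n : nat) : le_natinf n.+1 r -> is_atlas (Some n) (tangent_bundle X).
Proof.
move=> nr; split.
- by move=> p; have [i ip] := chart_cover aX (foot p); exists i.
- by move=> i; exact: tchart_dom_open.
- move=> i; apply/seteqP; split=> [_ [p ip <-]|[y w] [/= iy _]].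
    by split=> //; exact: chart_dom_cod aX _ _ ip.
  by have [p ip pE] := tchart_surj w iy; exists p.
- by move=> i p q; rewrite !inE => ip iq; exact: tchart_inj.
- move=> i; apply/cont_onP; first exact: tchart_dom_open.
  exact: tchart_cont_on.
- move=> i A + Ai; rewrite tangent_openE => /(_ i)[W oW AW].
  rewrite (_ : _ @` _ = W `&` (chart_cod (c := X) i `*` setT)).
    by apply: openI oW _; exact: open_setX (chart_cod_open (c := X) i) openT.
  apply/seteqP; split=> [_ [p Ap <-]|[y w] [Wyw [/= iy _]]].
    split; first by apply/AW => //; exact: Ai.
    by split=> //; exact: chart_dom_cod aX _ _ (Ai _ Ap).
  by have [p ip pE] := tchart_surj w iy; exists p => //; apply/AW => //; rewrite pE.
- move=> i j m mn.
  have -> : chart (c := tangent_bundle X) i @` (chart_dom (c := tangent_bundle X) i `&`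
      chart_dom (c := tangent_bundle X) j) = overlap (X := X) i j `*` setT.
    apply/seteqP; split=> [_ [p [ip jp] <-]|[y w] [/= [x [ix jx] xy] _]].
      by split=> //=; exists (foot p).
    have iy : chart_cod (c := X) i y by rewrite -xy; exact: chart_dom_cod aX _ _ ix.
    have [p ip pE] := tchart_surj w iy; exists p => //; split=> //=.
    have <- // : x = foot p.
    by apply: (inj (i := i)); rewrite ?inE// xy; case: pE.
  have oT : open (overlap (X := X) i j `*` [set: M] : set (M * M)).
    exact: open_setX (overlap_open aX i j) openT.
  apply/is_Cn_Cn_on => //.
  apply: (@Cn_on_ext _ _ _ _ _ _ (Ttrans i j)) => //; last first.
    by exact: (Cn_on_le mn (Ttrans_Cn i j nr)).
  move=> [y w] [/= [x [ix jx] xy] _].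
  have iy : chart_cod (c := X) i y by rewrite -xy; exact: chart_dom_cod aX _ _ ix.
  have [p ip pE] := tchart_surj w iy.
  have xp : x = foot p by apply: (inj (i := i)); rewrite ?inE// xy; case: pE.
  have jp : chart_dom (c := X) j (foot p) by rewrite -xp.
  rewrite -pE -(TtransE ip jp).
  symmetry; apply: (@in_chartE _ (tangent_bundle X) (M * M)%type (tchart (X := X) j) i p) => //.
  by move=> p1 p2; rewrite !inE => ip1 ip2; exact: tchart_inj.
Qed.

(** Tangent vectors with different feet are separated by their feet; those
with the same foot are separated in one chart. *)
Lemma tangent_hausdorff : hausdorff_space X -> hausdorff_space (tangent_bundle X).
Proof.
move=> hX p q pq; have fpq : foot p = foot q.
  apply: hX => A B Ap Bq.
  have [z [Az Bz]] := pq _ _ (foot_continuous Ap) (foot_continuous Bq).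
  by exists (foot z).
have [i ip] := chart_cover aX (foot p); have iq : chart_dom i (foot q) by rewrite -fpq.
apply: (tchart_inj ip iq); apply: (lctvs_hausdorff (E := (M * M)%type)) => A B.
rewrite !nbhsE => -[A' [oA' A'p] A'A] [B' [oB' B'q] B'B].
have [|| z [[iz Az] [_ Bz]]] := pq [set p : tangent X | chart_dom i (foot p) /\ A' (tchart i p)]
  [set p : tangent X | chart_dom i (foot p) /\ B' (tchart i p)].
- by apply: open_nbhs_nbhs; split=> //; exact: tchart_open.
- by apply: open_nbhs_nbhs; split=> //; exact: tchart_open.
by exists (tchart i z); split; [exact: A'A|exact: B'B].
Qed.

(** The value does not depend on the chart, by [dd_in_chart]. *)
Lemma dmapE E {lE : lctvs E} (g : X -> E) : (forall i, Cn_on 1 (chart_cod i) (in_chart g i)) ->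
  forall i p, chart_dom i (foot p) -> dmap g p = dd (in_chart g i) (tchart i p).
Proof.
move=> cg i p ip; rewrite /dmap /tangent_map /=; apply: xget_unique; first by exists i.
move=> _ [j jp <-].
by rewrite /tchart (dd_in_chart aX _ r1 (cg j) ip jp) -(tvec_compat ip jp).
Qed.

Lemma in_chart_dmap E {lE : lctvs E} (g : X -> E) :
  (forall i, Cn_on 1 (chart_cod i) (in_chart g i)) ->
  forall i (y : M * M), (chart_cod i `*` setT) y ->
  in_chart (X := tangent_bundle X) (dmap g) i y = dd (in_chart g i) y.
Proof.
move=> cg i [y w] [/= iy _]; have [p ip <-] := tchart_surj w iy.
rewrite (@in_chartE _ (tangent_bundle X) _ (dmap g) i p)//; first exact: dmapE.
by move=> p1 p2; rewrite !inE => ip1 ip2; exact: tchart_inj.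
Qed.

End Tangent.

Definition Cn_map n M (X : chartedSpace M) E (g : X -> E) :=
  forall i, Cn_on n (chart_cod i) (in_chart g i).

Lemma Cn_map_dmap n M {lM : lctvs M} (X : chartedSpace M) E {lE : lctvs E} (g : X -> E) :
  is_atlas (Some n.+1) X -> Cn_map n.+1 g -> Cn_map n (X := tangent_bundle X) (dmap g).
Proof.
move=> aX sg i.
have s1 j : Cn_on 1 (chart_cod j) (in_chart g j) by apply: Cn_on_le (sg j).
apply: (@Cn_on_ext _ _ _ _ _ _ (dd (in_chart g i))); last exact: (sg i).2.2.
  exact: (@chart_cod_open _ _ (tangent_bundle X) i).
by move=> p ip; rewrite (in_chart_dmap aX).
Qed.

Lemma Cn_map_continuous n M (X : chartedSpace M) E (g : X -> E) r :
  is_atlas r X -> Cn_map n g -> continuous g.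
Proof.
move=> aX sg x; have [i ix] := chart_cover aX x.
suff : cont_on (chart_dom i) g by apply.
apply: (@cont_on_ext _ _ _ (in_chart g i \o chart i)); first exact: chart_dom_open aX i.
  by move=> y iy /=; rewrite in_chartE//; exact: chart_inj aX i.
apply: cont_on_comp (Cn_on_cont (sg i)) (chart_cont_on aX (i := i)) _.
by move=> y; exact: (chart_dom_cod aX).
Qed.

End Charts.

(** * The compact-open topology read in charts *)

(** In a Hausdorff space a compact set is regular: v has a closed neighbourhood that
misses the part of K outside O.  The piece K0 is a neighbourhood of v relative to K. *)
Lemma compact_cut (S : topologicalType) (K O : set S) (v : S) :
  hausdorff_space S -> compact K -> open O -> O v ->
  exists K0, [/\ compact K0, K0 `<=` O, K0 `<=` K & nbhs v [set x | K x -> K0 x]].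
Proof.
move=> hS cK oO Ov.
have cL : compact (K `&` ~` O) by apply: compact_closedI => //; exact: open_closedC.
have sep x : (K `&` ~` O) x ->
    \forall x' \near x & A \near powerset_filter_from (nbhs v), ~ closure A x'.
  move=> [Kx Ox]; have vx : v != x by apply/eqP => vx; apply: Ox; rewrite -vx.
  have := hS; rewrite open_hausdorff => /(_ _ _ vx)[[A B] /= [vA xB] [oA oB AB]].
  rewrite !inE in vA xB.
  exists (B, [set A' | A' `<=` A]) => /=.
    by split; [exact: open_nbhs_nbhs|apply: small_set_sub; exact: open_nbhs_nbhs].
  move=> [x' A'] [/= Bx' A'A] /(_ B (open_nbhs_nbhs (conj oB Bx')))[z [/A'A Az Bz]].
  by move/eqP: AB => /seteqP[+ _] => /(_ z)[].
move/compact_near_coveringP : cL => /(_ _ _ _ _ sep) cov.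
near (powerset_filter_from (nbhs v)) => A.
have vA : nbhs v A by exact: (near (near_small_set _)).
have LA : K `&` ~` O `<=` [set x | ~ closure A x] by near: A; exact: cov.
exists (K `&` closure A); split.
- by apply: compact_closedI => //; exact: closed_closure.
- by move=> x [Kx Ax]; apply: contrapT => Ox; apply: (LA x).
- exact: subIsetl.
- by apply: filterS vA => x Ax Kx; split=> //; exact: subset_closure.
Unshelve. all: by end_near. Qed.

Section ChartTopology.
Context {R : realType}.
Implicit Types E M : preTopologicalLmodType R.

Lemma chart_section M (X : chartedSpace M) r (aX : is_atlas r X) (i : chart_idx X)
  (x0 : X) : exists s : M -> X, cont_on (chart_cod i) s /\
    forall y, chart_cod i y -> chart_dom i (s y) /\ chart i (s y) = y.
Proof.
have inj := chart_inj aX (i := i).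
exists (fun y => odflt x0 (chart_inv i y)); split; last first.
  by move=> y /(chart_codP aX)[x ix <-]; rewrite chart_invE.
move=> y /(chart_codP aX)[x ix <-]; rewrite chart_invE//= => A.
rewrite nbhsE => -[A' [oA' A'x] A'A].
have oAi : open (A' `&` chart_dom i) by apply: openI oA' _; exact: (chart_dom_open aX).
have oC := chart_open_map aX oAi (subIsetr (A := _) (B := _)).
have : nbhs (chart i x) (chart i @` (A' `&` chart_dom i)).
  by apply: open_nbhs_nbhs; split=> //; exists x.
apply: filterS => _ [z [A'z iz] <-]; rewrite /preimage /= chart_invE//=.
exact: A'A.
Qed.

(** From X to a chart, compact sets are transported by a section of the
chart; from a chart to X, a compact set is first replaced by a piece around v
inside the chart domain. *)
Lemma cconv_charts M (X : chartedSpace M) r (aX : is_atlas r X)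
  (hX : hausdorff_space X) E T (G : set_system T) {FG : Filter G}
  (g : T -> X -> E) (g0 : X -> E) :
  cconv true G setT g g0 <->
  forall i : chart_idx X, cconv true G (chart_cod i) (fun t => in_chart (g t) i) (in_chart g0 i).
Proof.
have chE (h : X -> E) (i : chart_idx X) x : chart_dom i x -> in_chart h i (chart i x) = h x.
  by move=> ix; rewrite in_chartE//; exact: (chart_inj aX).
split=> [gg0 i K cK KU v Kv|gg0 K cK _ v Kv].
  have [x0 _ _] := chart_codP aX (KU v Kv).
  have [s [cs sE]] := chart_section aX i x0.
  have hE (h : X -> E) y : chart_cod i y -> (h \o s) y = in_chart h i y.
    by move=> /sE[ix iy] /=; rewrite -[in RHS]iy chE.
  suff : cconv true G (chart_cod i) (fun t => in_chart (g t) i) (in_chart g0 i) by exact.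
  apply: cconv_ext (cconv_precomp cs _ gg0) => // [t|]; exact: hE.
have [i iv] := chart_cover aX v.
have [K0 [cK0 K0i K0K vK0]] := compact_cut hX (cK isT) (chart_dom_open aX i) iv.
have gi : cconv true G (chart_dom i) g g0.
  apply: cconv_ext (cconv_precomp (chart_cont_on aX (i := i)) (chart_dom_cod aX (i := i)) (gg0 i)).
    by move=> t x ix /=; rewrite chE.
  by move=> x ix /=; rewrite chE.
have K0v : K0 v by exact: (nbhs_singleton vK0).
apply: cvg_trans (gi K0 (fun=> cK0) K0i v K0v).
move=> A [[P Q] [/= GP wQ] PQ]; exists (P, Q) => //; split=> //=.
move: wQ; rewrite /within /=; apply: filterS2 vK0 => x KK0 QK Kx; exact/QK/KK0.
Qed.

Section Fixed.
Context {T : Type} {G : set_system T} {FG : Filter G}.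

(** The analogue of [jet_conv] for the maps [dmap g] on tangent bundles. *)
Fixpoint tangent_conv (n : nat) M (X : chartedSpace M) E (g : T -> X -> E) (g0 : X -> E) : Prop :=
  cconv true G setT g g0 /\
  if n is m.+1 then @tangent_conv m (M * M)%type (tangent_bundle X) E
    (fun t => dmap (g t)) (dmap g0) else True.

(** The induction passes from X to its tangent bundle, which has the same set of charts. *)
Lemma tangent_convP n M {lM : lctvs M} (X : chartedSpace M) E {lE : lctvs E}
  (g : T -> X -> E) (g0 : X -> E) :
  is_atlas (Some n) X -> hausdorff_space X -> (forall t, Cn_map n (g t)) -> Cn_map n g0 ->
  tangent_conv n g g0 <->
  forall i : chart_idx X, jet_conv true G n (chart_cod i) (fun t => in_chart (g t) i) (in_chart g0 i).
Proof.
elim: n M lM X g g0 => [|n IHn] M lM X g g0 aX hX sg sg0 /=.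
  rewrite (cconv_charts aX hX); split=> [[gg0 _] i|gg0]; first by split.
  by split=> // i; have [] := gg0 i.
have aT : is_atlas (Some n) (tangent_bundle X) by exact: (tangent_atlas aX isT (leqnn _)).
have hT : hausdorff_space (tangent_bundle X) by exact: (tangent_hausdorff aX).
rewrite (cconv_charts aX hX) (IHn _ _ _ _ _ aT hT); last 2 first.
- by move=> t; exact: Cn_map_dmap.
- exact: Cn_map_dmap.
have s1 (h : X -> E) : Cn_map n.+1 h -> forall j, Cn_on 1 (chart_cod j) (in_chart h j).
  by move=> sh j; exact: Cn_on_le (sh j).
have dE (h : X -> E) : Cn_map n.+1 h -> forall (i : chart_idx X) (p : M * M),
    (chart_cod i `*` setT) p ->
    in_chart (X := tangent_bundle X) (dmap h) i p = dd (in_chart h i) p.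
  by move=> sh i p ip; apply: (in_chart_dmap aX) => //; exact: s1.
have oT (i : chart_idx X) : open (chart_cod i `*` [set: M] : set (M * M)).
  exact: open_setX (chart_cod_open i) openT.
split=> [[gg0 dg] i|gg0].
  split=> //; apply: (jet_conv_ext (lctvs_prod lM lM) (oT i) _ _ (dg i)) => [t p ip|p ip];
    exact: dE.
split=> i; have [gi dgi] := gg0 i => //.
by apply: (jet_conv_ext (lctvs_prod lM lM) (oT i) _ _ dgi) => [t p ip|p ip]; symmetry; exact: dE.
Qed.

End Fixed.

Section Jets.
Variables (E : preTopologicalLmodType R) (T : Type).

Let jet := {M : preTopologicalLmodType R & {X : chartedSpace M & ((T -> X -> E) * (X -> E))%type}}.
Let mk M (X : chartedSpace M) (g : T -> X -> E) (g0 : X -> E) : jet :=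
  existT _ M (existT _ X (g, g0)).
Let step (p : jet) : jet := mk (X := tangent_bundle (projT1 (projT2 p)))
  (fun t => dmap ((projT2 (projT2 p)).1 t)) (dmap (projT2 (projT2 p)).2).

Let iterE j M (X : chartedSpace M) (g : T -> X -> E) (g0 : X -> E) :
  iter j step (mk g g0) = mk (fun t => dnmap j (g t)) (dnmap j g0).
Proof. by elim: j => //= j ->. Qed.

(** As for [is_Cn_Cn_on], iterating the step (M, X, g) |-> (M x M, TX, dmap g) on
triples makes T^n (TX) and T (T^n X) meet without casts. *)
Lemma tangent_conv_dnmap (G : set_system T) n M (X : chartedSpace M) (g : T -> X -> E) g0 :
  tangent_conv (G := G) n g g0 <-> forall j, (j <= n)%N ->
    cconv true G setT (fun t => dnmap j (g t)) (dnmap j g0).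
Proof.
pose P (p : jet) := cconv true G setT (projT2 (projT2 p)).1 (projT2 (projT2 p)).2.
transitivity (forall j, (j <= n)%N -> P (iter j step (mk g g0))); last first.
  by split=> H j /H; rewrite iterE.
elim: n M X g g0 => [|n IHn] M X g g0 /=.
  by split=> [[gg0 _] [|//]|/(_ 0 isT)].
rewrite IHn; split=> [[gg0 dg] [//|j]|gg0]; first by rewrite iterSr => /dg.
split; first exact: (gg0 0).
by move=> j jn; have := gg0 j.+1 jn; rewrite iterSr.
Qed.

End Jets.

Lemma dnmap_continuous j n M {lM : lctvs M} (X : chartedSpace M) E {lE : lctvs E} (g0 : X -> E) :
  is_atlas (Some n) X -> Cn_map n g0 -> (j <= n)%N -> continuous (dnmap j g0).
Proof.
pose jet := {M : preTopologicalLmodType R & {X : chartedSpace M & X -> E}}.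
pose mk M (X : chartedSpace M) (g0 : X -> E) : jet := existT _ M (existT _ X g0).
pose step (p : jet) : jet := mk _ (tangent_bundle (projT1 (projT2 p))) (dmap (projT2 (projT2 p))).
have iterE : iter j step (mk _ _ g0) = mk _ _ (dnmap j g0) by elim: j => //= j ->.
pose P (p : jet) := continuous (projT2 (projT2 p)).
move=> aX sg jn; suff : P (iter j step (mk _ _ g0)) by rewrite iterE.
clear iterE; elim: n j M lM X g0 aX sg jn => [|n IHn] [|j] M lM X g0 aX sg jn //.
- exact: (Cn_map_continuous aX sg).
- exact: (Cn_map_continuous aX sg).
rewrite iterSr; apply: IHn => //; first exact: (tangent_atlas aX isT (leqnn _)).
exact: Cn_map_dmap.
Qed.

(** From left to right, K is covered by finitely many of the
neighbourhoods given by continuous convergence.  From right to left, the compact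
set to test is the part of K where g0 takes values in a closed neighbourhood of
g0 v. *)
Lemma cconv_compact_open (Y : topologicalType) E {lE : lctvs E} T (G : set_system T)
  {FG : Filter G} (g : T -> Y -> E) (g0 : Y -> E) : continuous g0 ->
  cconv true G setT g g0 <->
  (g : T -> {compact-open, Y -> E}) @ G --> (g0 : {compact-open, Y -> E}).
Proof.
move=> cg0; split=> [gg0|gg0 K cK _ v Kv W gW].
  apply/compact_open_cvgP => K O cK oO g0K.
  move/compact_near_coveringP/near_covering_withinP : (cK) => /(_ T G (fun t x => O (g t x)) _).
  have H x : K x -> \forall x' \near x & t \near G, K x' -> O (g t x').
    move=> Kx; have : nbhs (g0 x) O.
      by apply: open_nbhs_nbhs; split=> //; apply: g0K; exists x.
    move=> /(cvg_preimage_mem (gg0 K (fun=> cK) (@subsetT _ _) x Kx)) [[P Q] [/= GP wQ] PQ].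
    exists ([set x | K x -> Q x], P) => //= -[x' t] [/= QK Pt] Kx'.
    by apply: (PQ (t, x')); split=> //=; exact: QK.
  move=> /(_ H); apply: filterS => t KO _ [x Kx <-]; exact: KO.
have oW : nbhs (g0 v) (interior W) by exact: nbhs_interior.
(* The part of K over the closed set W' is compact, and is mapped by g0 into
   the open set which the compact-open topology requires. *)
have [W' [gW' clW' W'W]] := lctvs_regular lE oW.
have cK0 : compact (K `&` g0 @^-1` W').
  by apply: compact_closedI; [exact: cK|apply: preimage_closed => // x _; exact: cg0].
have /compact_open_cvgP/(_ _ _ cK0 (open_interior W)) := gg0.
have gK0 : g0 @` (K `&` g0 @^-1` W') `<=` interior W by move=> _ [x [_ /W'W ?] <-].
move=> /(_ gK0) GK0.
exists ([set t | g t @` (K `&` g0 @^-1` W') `<=` interior W],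
  [set x | K x /\ W' (g0 x)]) => /=.
  split=> //; rewrite /within /=.
  by have := cvg_preimage_mem (cg0 v) gW'; apply: filterS => x W'x Kx; split.
move=> [t x] [/= tK [Kx W'x]]; apply: interior_subset; apply: tK.
by exists x.
Qed.

Lemma cvg_initial (S : choiceType) (Z : topologicalType) (f : S -> Z)
  (F : set_system S) (s : S) : Filter F ->
  F --> (s : initial_topology f) <-> f @ F --> f s.
Proof.
move=> FF; split=> [Fs|Fs A].
  by move=> A /(@initial_continuous _ _ f s) /Fs.
rewrite nbhsE => -[B [[V oV VB] Bs] BA]; rewrite -VB in Bs BA.
have : nbhs (f s) V by exact: open_nbhs_nbhs.
by move=> /(cvg_preimage_mem Fs); apply: filterS => x /BA.
Qed.

End ChartTopology.

(** * Families of maps of class C^r on a charted space *)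

Lemma le_natinf_trans m n r : (m <= n)%N -> le_natinf n r -> le_natinf m r.
Proof. by case: r => //= r; exact: leq_trans. Qed.

Section Reparam.
Context {R : realType} {b : bool} {T T' : Type} {G : set_system T} {G' : set_system T'}.
Context {FG : Filter G} {FG' : Filter G'}.

Lemma cconv_reparam (S Z : topologicalType) (U : set S) (pi : T' -> T)
  (g : T -> S -> Z) (g0 : S -> Z) : pi @ G' --> G ->
  cconv b G U g g0 -> cconv b G' U (fun t => g (pi t)) g0.
Proof.
move=> piG gg0 K cK KU v Kv.
apply: (@cvg_comp _ _ _ (fun p => (pi p.1, p.2)) (fun p => g p.1 p.2) _
  (filter_prod G (within K (nbhs v)))); last exact: gg0.
apply: cvg_filter_prod; last exact: cvg_snd.
by apply: (@cvg_comp _ _ _ fst pi _ G'); [exact: cvg_fst|exact: piG].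
Qed.

Lemma jet_conv_reparam n (E F : preTopologicalLmodType R) (U : set E) (pi : T' -> T)
  (g : T -> E -> F) (g0 : E -> F) : pi @ G' --> G ->
  jet_conv b G n U g g0 -> jet_conv b G' n U (fun t => g (pi t)) g0.
Proof.
move=> piG; elim: n E U g g0 => [|n IHn] E U g g0 /= [gg0 dg].
  by split=> //; exact: cconv_reparam gg0.
by split; [exact: cconv_reparam gg0|exact: (IHn _ _ (fun t => dd (g t)))].
Qed.

End Reparam.

Section Line.
Context {R : realType}.
Implicit Types E F : preTopologicalLmodType R.

Lemma cconv_line (S : topologicalType) F {lF : lctvs F} (U : set S) (g h : S -> F) (t0 : R) :
  cont_on U g -> cont_on U h ->
  cconv false (nbhs t0) U (fun t x => g x + t *: h x) (fun x => g x + t0 *: h x).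
Proof.
move=> cg ch K _ KU v Kv; apply: lcvgD.
  apply: (@cvg_comp _ _ _ snd g _ (within K (nbhs v))); first exact: cvg_snd.
  by apply: cvg_within_fmap; exact: (cg v (KU v Kv)).
apply: lcvgZ; first exact: cvg_fst.
apply: (@cvg_comp _ _ _ snd h _ (within K (nbhs v))); first exact: cvg_snd.
by apply: cvg_within_fmap; exact: (ch v (KU v Kv)).
Qed.

Lemma Cn_on_line n E F {lE : lctvs E} {lF : lctvs F} (U : set E) (g h : E -> F) (t : R) :
  open U -> Cn_on n U g -> Cn_on n U h -> Cn_on n U (fun x => g x + t *: h x).
Proof.
move=> oU cg ch; apply: (@Cn_on_ext _ _ _ _ _ _ (fun x => t *: h x + g x)) => //.
  by move=> x _; rewrite addrC.
exact: Cn_on_lincomb.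
Qed.

Lemma jet_conv_line n E F {lE : lctvs E} {lF : lctvs F} (U : set E) (g h : E -> F) (t0 : R) :
  open U -> Cn_on n U g -> Cn_on n U h ->
  jet_conv false (nbhs t0) n U (fun t x => g x + t *: h x) (fun x => g x + t0 *: h x).
Proof.
elim: n E lE U g h => [|n IHn] E lE U g h oU cg ch.
  by split=> //; apply: cconv_line; [exact: Cn_on_cont cg|exact: Cn_on_cont ch].
split; first by apply: cconv_line; [exact: Cn_on_cont cg|exact: Cn_on_cont ch].
have oUT : open (U `*` [set: E] : set (E * E)) by exact: open_setX oU openT.
have ddE (t : R) (p : E * E) : (U `*` setT) p ->
    dd g p + t *: dd h p = dd (fun x => g x + t *: h x) p.
  move=> [Up _]; symmetry.
  have -> : (fun x => g x + t *: h x) = (fun x => t *: h x + g x).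
    by apply/funext => x; rewrite addrC.
  have := deriv_on_dd lF (deriv_on_lincomb lF (a := t) ch.2.1 cg.2.1) Up.
  by move=> ->; rewrite addrC.
apply: (jet_conv_ext (lctvs_prod lE lE) oUT _ _ (IHn _ _ _ _ _ oUT cg.2.2 ch.2.2)) => [t p|p];
  exact: ddE.
Qed.

End Line.

Section CrMaps.
Context {R : realType} {M : preTopologicalLmodType R} {lM : lctvs M}.
Context {X : chartedSpace M} {r : natinf}.
Hypothesis aX : le_natinf 1 r -> is_atlas r X.
Implicit Types E F : preTopologicalLmodType R.

(** The convergence of C^r(X, E) in charts, see [cvg_CrP]; for r = 0 the charts
are disregarded as X is only a topological space. *)
Definition Cr_conv b T (G : set_system T) E (g : T -> X -> E) (g0 : X -> E) :=
  cconv b G setT g g0 /\ (le_natinf 1 r -> forall n, le_natinf n r -> forall i : chart_idx X,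
    jet_conv b G n (chart_cod i) (fun t => in_chart (g t) i) (in_chart g0 i)).

Lemma Cr_mapP E {lE : lctvs E} (g : X -> E) : is_Cr_map r X g <->
  continuous g /\ (le_natinf 1 r -> forall n, le_natinf n r -> Cn_map n g).
Proof.
split=> -[cg sg]; split=> // r1.
  by move=> n nr i; apply/is_Cn_Cn_on; [exact: chart_cod_open|exact: sg].
by move=> i n nr; apply/is_Cn_Cn_on; [exact: chart_cod_open|exact: sg].
Qed.

Lemma Cr_map_pair E F {lE : lctvs E} {lF : lctvs F} (g : X -> E) (h : X -> F) :
  is_Cr_map r X g -> is_Cr_map r X h ->
  is_Cr_map (E := (E * F)%type) r X (fun x => (g x, h x)).
Proof.
move=> /Cr_mapP[cg sg] /Cr_mapP[ch sh]; apply/Cr_mapP; split.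
  by move=> x; apply: cvg_pair; [exact: cg|exact: ch].
move=> r1 n nr i.
have -> : in_chart (fun x => (g x, h x) : (E * F)%type) i =
    fun y => (in_chart g i y, in_chart h i y).
  by apply/funext => y; rewrite /in_chart; case: chart_inv.
by apply: Cn_on_pair => //; [exact: chart_cod_open|exact: sg|exact: sh].
Qed.

(** The chart representation of x |-> f (x, h x) is the composition of that of f
with the graph of that of h. *)
Lemma in_chart_graph (E : preTopologicalLmodType R) (F : lmodType R) (f : X * E -> F) (h : X -> E)
  (i : chart_idx X) (y : M) : le_natinf 1 r -> chart_cod i y ->
  in_chart (X := prod_charted X E) f i (y, in_chart h i y) =
  in_chart (fun x => f (x, h x)) i y.
Proof.
move=> r1 /(chart_codP (aX r1))[x ix <-].
have inj := chart_inj (aX r1) (i := i).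
rewrite !in_chartE//.
apply: (@in_chartE _ _ (prod_charted X E) _ f i (x, h x)) => // -[x1 e1] [x2 e2].
rewrite !inE => -[/= i1 _] [/= i2 _] [x12 ->]; congr pair.
by apply: inj x12; rewrite inE.
Qed.

Lemma Cr_map_graph E F {lE : lctvs E} {lF : lctvs F} (f : X * E -> F) (h : X -> E) :
  is_Cr_map r (prod_charted X E) f -> is_Cr_map r X h ->
  is_Cr_map r X (fun x => f (x, h x)).
Proof.
move=> [cf sf] /Cr_mapP[ch sh]; apply/Cr_mapP; split.
  move=> x; apply: (@cvg_comp _ _ _ (fun x => (x, h x)) f _ (nbhs (x, h x))); last exact: cf.
  by apply: cvg_pair; [exact: cvg_id|exact: ch].
move=> r1 n nr i.
have cfn : Cn_on n (chart_cod i `*` [set: E] : set (M * E)) (in_chart (X := prod_charted X E) f i).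
  apply/is_Cn_Cn_on; [exact: open_setX (chart_cod_open i) openT|exact: (sf r1 i)].
have oi := chart_cod_open i.
apply: (@Cn_on_ext _ _ _ _ _ _ (in_chart (X := prod_charted X E) f i \o
    (fun y => (y, in_chart h i y)))) => //.
  by move=> y iy /=; rewrite in_chart_graph.
apply: Cn_on_comp cfn _ _ => //; first exact: open_setX oi openT.
by apply: Cn_on_pair => //; [apply: Cn_on_lin => //; exact: linear_cont_id|exact: sh].
Qed.

Section Fixed.
Context {b : bool} {T : Type} {G : set_system T} {FG : Filter G}.

Lemma Cr_conv_reparam T' (G' : set_system T') {FG' : Filter G'} (pi : T' -> T) E
  (g : T -> X -> E) (g0 : X -> E) : pi @ G' --> G -> Cr_conv b G g g0 ->
  Cr_conv b G' (fun t => g (pi t)) g0.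
Proof.
move=> piG [cg fg]; split; first exact: cconv_reparam cg.
by move=> r1 n nr i; exact: (jet_conv_reparam piG (fg r1 n nr i)).
Qed.

Lemma Cr_conv_pair E F {lE : lctvs E} {lF : lctvs F} (g : T -> X -> E) (g0 : X -> E)
  (h : T -> X -> F) (h0 : X -> F) :
  (forall t, is_Cr_map r X (g t)) -> is_Cr_map r X g0 ->
  (forall t, is_Cr_map r X (h t)) -> is_Cr_map r X h0 ->
  Cr_conv b G g g0 -> Cr_conv b G h h0 ->
  Cr_conv b G (E := (E * F)%type) (fun t x => (g t x, h t x)) (fun x => (g0 x, h0 x)).
Proof.
move=> sg sg0 sh sh0 [cg fg] [ch fh]; split; first exact: cconv_pair.
move=> r1 n nr i.
have ss (F' : preTopologicalLmodType R) (lF' : lctvs F') (u : X -> F') : is_Cr_map r X u ->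
    Cn_on n (chart_cod i) (in_chart u i).
  by move=> /Cr_mapP[_ su]; exact: su.
have iE (u : X -> E) (v : X -> F) y : (in_chart u i y, in_chart v i y) =
    in_chart (fun x => (u x, v x) : (E * F)%type) i y.
  by rewrite /in_chart; case: chart_inv.
have oi := chart_cod_open i.
apply: (jet_conv_ext lM oi (fun t y _ => iE (g t) (h t) y) (fun y _ => iE g0 h0 y)).
by apply: jet_conv_pair => //; [move=> t; exact: ss|exact: ss|move=> t; exact: ss|
  exact: ss|exact: fg|exact: fh].
Qed.

Lemma Cr_conv_graph E F {lE : lctvs E} {lF : lctvs F} (f : X * E -> F)
  (g : T -> X -> E) (g0 : X -> E) :
  is_Cr_map r (prod_charted X E) f -> (forall t, is_Cr_map r X (g t)) -> is_Cr_map r X g0 ->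
  Cr_conv b G g g0 -> Cr_conv b G (fun t x => f (x, g t x)) (fun x => f (x, g0 x)).
Proof.
move=> [cf sf] sg sg0 [cg fg]; split.
  apply: (cconv_comp (f := f) (V := setT) (g := fun t x => (x, g t x))
    (g0 := fun x => (x, g0 x))) => //; first exact: cont_on_continuous.
  by apply: cconv_pair => //; apply: cconv_cst => x _; exact: cvg_id.
move=> r1 n nr i; have oi := chart_cod_open i.
have cfn : Cn_on n (chart_cod i `*` [set: E] : set (M * E)) (in_chart (X := prod_charted X E) f i).
  apply/is_Cn_Cn_on; [exact: open_setX (chart_cod_open i) openT|exact: (sf r1 i)].
have ss (u : X -> E) : is_Cr_map r X u -> Cn_on n (chart_cod i) (in_chart u i).
  by move=> /Cr_mapP[_ su]; exact: su.
have cid : Cn_on n (chart_cod i) (@id M) by apply: Cn_on_lin => //; exact: linear_cont_id.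
have cgr (u : X -> E) : is_Cr_map r X u ->
    Cn_on n (chart_cod i) (fun y => (id y, in_chart u i y)).
  by move=> su; apply: Cn_on_pair => //; exact: ss.
apply: (jet_conv_ext lM oi (fun t y iy => in_chart_graph f (g t) r1 iy)
  (fun y iy => in_chart_graph f g0 r1 iy)).
apply: (jet_conv_comp _ _ _ oi _ cfn) => //; first exact: open_setX oi openT.
- by move=> t; exact: cgr.
- exact: cgr.
- exact: (jet_conv_pair lM lM lE oi (fun=> cid) cid (fun t => ss _ (sg t)) (ss _ sg0)
    (jet_conv_cst cid) (fg r1 n nr i)).
Qed.

End Fixed.

Lemma Cr_map_line E {lE : lctvs E} (g h : X -> E) (t : R) : is_Cr_map r X g ->
  is_Cr_map r X h -> is_Cr_map r X (fun x => g x + t *: h x).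
Proof.
move=> /Cr_mapP[cg sg] /Cr_mapP[ch sh]; apply/Cr_mapP; split.
  by move=> x; apply: lcvgD; [exact: cg|apply: lcvgZr; exact: ch].
move=> r1 n nr i.
have -> : in_chart (fun x => g x + t *: h x) i = fun y => in_chart g i y + t *: in_chart h i y.
  by apply/funext => y; rewrite /in_chart; case: chart_inv => //=; rewrite scaler0 addr0.
by apply: Cn_on_line; [exact: chart_cod_open|exact: sg|exact: sh].
Qed.

Lemma Cr_conv_line E {lE : lctvs E} (g h : X -> E) (t0 : R) : is_Cr_map r X g ->
  is_Cr_map r X h ->
  Cr_conv false (nbhs t0) (fun t x => g x + t *: h x) (fun x => g x + t0 *: h x).
Proof.
move=> /Cr_mapP[cg sg] /Cr_mapP[ch sh]; split.
  by apply: cconv_line; exact: cont_on_continuous.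
move=> r1 n nr i; have oi := chart_cod_open i.
have iE (t : R) y : in_chart g i y + t *: in_chart h i y = in_chart (fun x => g x + t *: h x) i y.
  by rewrite /in_chart; case: chart_inv => //=; rewrite scaler0 addr0.
apply: (jet_conv_ext lM oi (fun t y _ => iE t y) (fun y _ => iE t0 y)).
by apply: jet_conv_line => //; [exact: sg|exact: sh].
Qed.

Lemma Cr_conv_weak T (G : set_system T) {FG : Filter G} E (g : T -> X -> E) (g0 : X -> E) :
  Cr_conv false G g g0 -> Cr_conv true G g g0.
Proof.
move=> [cg fg]; split; first exact: cconv_weak.
by move=> r1 n nr i; apply: jet_conv_weak; exact: fg.
Qed.

(** The differentiability of the superposition operator, without reference
to the topology of C^r(X, F): u t and v t below are the values at g + t h of
the superposition operators of f0 and f1, and v is the t-derivative of u. *)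
Lemma Cr_conv_quot E F {lE : lctvs E} {lF : lctvs F} (f0 : X * E -> F)
  (f1 : X * (E * E)%type -> F) (g h : X -> E) :
  (forall x, deriv_on setT (fun y => f0 (x, y)) (fun p => f1 (x, p))) ->
  is_Cr_map r (prod_charted X E) f0 -> is_Cr_map r (prod_charted X (E * E)%type) f1 ->
  is_Cr_map r X g -> is_Cr_map r X h ->
  Cr_conv false (0 : R)^' (fun t x => t^-1 *: (f0 (x, g x + t *: h x) - f0 (x, g x)))
    (fun x => f1 (x, (g x, h x))).
Proof.
move=> df cf0 cf1 cg ch.
pose u t x := f0 (x, g x + t *: h x); pose v t x := f1 (x, (g x + t *: h x, h x)).
have cu t : is_Cr_map r X (u t) by apply: Cr_map_graph cf0 _; exact: Cr_map_line.
have cgh t : is_Cr_map (E := (E * E)%type) r X (fun x => (g x + t *: h x, h x)).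
  by apply: Cr_map_pair => //; exact: Cr_map_line.
have cv t : is_Cr_map r X (v t) by exact: Cr_map_graph cf1 (cgh t).
have duv t x : curve_deriv (u^~ x) t (v t x).
  rewrite /curve_deriv /u (_ : (fun s : R => _) = diffq (fun y => f0 (x, y)) (g x + t *: h x) (h x)).
    exact: df.
  by apply/funext => s; rewrite /diffq scalerDl addrA.
have cch t0 : Cr_conv false (nbhs (t0 : R)) (fun _ : R => h) h.
  split; first by apply: cconv_cst; apply: cont_on_continuous; case: ch.
  by move=> r1 n nr i; apply: jet_conv_cst; move/Cr_mapP: ch => [_]; exact.
have ccv t0 : Cr_conv false (nbhs t0) v (v t0).
  apply: (Cr_conv_graph (g := fun t x => (g x + t *: h x, h x) : (E * E)%type)
    (g0 := fun x => (g x + t0 *: h x, h x))) => //.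
  apply: (Cr_conv_pair (h := fun=> h)) => //; last exact: Cr_conv_line.
  - by move=> t; exact: Cr_map_line.
  - exact: Cr_map_line.
have E0 x : f0 (x, g x) = u 0 x by rewrite /u scale0r addr0.
have -> : (fun t x => t^-1 *: (f0 (x, g x + t *: h x) - f0 (x, g x))) =
    fun t x => t^-1 *: (u (0 + t) x - u 0 x).
  by apply/funext => t; apply/funext => x; rewrite E0 add0r.
have -> : (fun x => f1 (x, (g x, h x))) = v 0.
  by apply/funext => x; rewrite /v scale0r addr0.
split; first by apply: (cconv_quot lF) => [t x _|t0]; [exact: duv|exact: (ccv t0).1].
move=> r1 n nr i; have oi := chart_cod_open i.
have iE t y : t^-1 *: (in_chart (u (0 + t)) i y - in_chart (u 0) i y) =
    in_chart (fun x => t^-1 *: (u (0 + t) x - u 0 x)) i y.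
  by rewrite /in_chart; case: chart_inv => //=; rewrite subrr scaler0.
apply: (jet_conv_ext lM oi (fun t y _ => iE t y) (fun y _ => erefl)).
apply: (jet_conv_quot lF lM (h := fun t => in_chart (u t) i) (k := fun t => in_chart (v t) i)) => //.
- by move=> t; move/Cr_mapP: (cu t) => [_]; exact.
- by move=> t; move/Cr_mapP: (cv t) => [_]; exact.
- move=> t y /(chart_codP (aX r1))[x ix <-].
  have inj := chart_inj (aX r1) (i := i).
  rewrite in_chartE//.
  rewrite (_ : (fun t => in_chart (u t) i (chart i x)) = u^~ x); first exact: duv.
  by apply/funext => s; rewrite in_chartE.
- by move=> t0; exact: ((ccv t0).2 r1 n nr i).
Qed.

End CrMaps.

Arguments Cr_conv {R M X} r b {T} G {E} g g0.

(** * The superposition operator on spaces of maps of class C^r *)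

Section CrSpace.
Context {R : realType} {r : natinf} {M : lcsType R} {X : chartedSpace M}.
Hypothesis hX : hausdorff_space X.
Hypothesis aX : le_natinf 1 r -> is_atlas r X.
Implicit Types E F : lcsType R.

Lemma Cr_spaceP E (g : Cr_space r X E) : is_Cr_map r X g.
Proof. by have := Cr_funP g; rewrite /Cr_pred inE. Qed.

Lemma Cr_space_ext E (g h : Cr_space r X E) : (forall x, g x = h x) -> g = h.
Proof. by move=> gh; apply: val_inj; apply/funext. Qed.

Lemma cvg_Cr_dnmap E T (G : set_system T) {FG : Filter G} (g : T -> Cr_space r X E)
  (g0 : Cr_space r X E) : g @ G --> g0 <->
  forall n, le_natinf n r -> (fun t => dnmap n (g t) : {compact-open, iter_tangent n X -> E})
    @ G --> (dnmap n g0 : {compact-open, iter_tangent n X -> E}).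
Proof.
have -> : (g @ G --> g0) = (g @ G --> (g0 : Cr_topology r X E)) by [].
rewrite cvg_sup; split=> [gg0 n nr|gg0 [n nr]].
  have /cvg_initial := gg0 (exist _ n nr); exact.
by apply/cvg_initial; exact: gg0.
Qed.

Lemma cvg_CrP E T (G : set_system T) {FG : Filter G} (g : T -> Cr_space r X E)
  (g0 : Cr_space r X E) : g @ G --> g0 <->
  Cr_conv r true G (fun t => g t : X -> E) g0.
Proof.
have aN n : le_natinf 1 r -> le_natinf n r -> is_atlas (Some n) X.
  move=> r1 nr; apply: is_atlas_sub (aX r1) => m mn; exact: le_natinf_trans mn nr.
have sN (h : Cr_space r X E) : le_natinf 1 r -> forall n, le_natinf n r -> Cn_map n h.
  by have /Cr_mapP[_] := Cr_spaceP h.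
have cg0 n : le_natinf n r -> continuous (dnmap n g0).
  case: n => [_|n nr]; first by have [] := Cr_spaceP g0.
  have r1 : le_natinf 1 r by exact: le_natinf_trans nr.
  exact: (dnmap_continuous (aN _ r1 nr) (sN g0 r1 _ nr) (leqnn _)).
rewrite cvg_Cr_dnmap; transitivity (forall n, le_natinf n r ->
    cconv true G setT (fun t => dnmap n (g t)) (dnmap n g0)).
  split=> H n nr; apply/cconv_compact_open => //; try exact: cg0; exact: H.
have mP n : le_natinf 1 r -> le_natinf n r -> tangent_conv (G := G) n (fun t => g t : X -> E) g0 <->
    forall i : chart_idx X, jet_conv true G n (chart_cod i)
      (fun t => in_chart (g t) i) (in_chart g0 i).
  by move=> r1 nr; apply: tangent_convP => //; [exact: aN|move=> t; exact: sN|exact: sN].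
have r0 : le_natinf 0 r by case: (r).
split=> [gg0|[gg0 fg] [|n] nr].
- split; first exact: (gg0 0 r0).
  move=> r1 n nr; apply/mP => //; apply/tangent_conv_dnmap => j jn; apply: gg0.
  exact: le_natinf_trans jn nr.
- exact: gg0.
- have r1 : le_natinf 1 r by exact: le_natinf_trans nr.
  by have /mP := fg r1 _ nr; move=> /(_ r1 nr) /tangent_conv_dnmap; apply.
Qed.

(** Convergence in C^r(X, E) implies pointwise convergence, since points
are compact. *)
Lemma Cr_cvg_unique E T (G : set_system T) {FG : ProperFilter G} (g : T -> Cr_space r X E)
  (g0 g1 : Cr_space r X E) : g @ G --> g0 -> g @ G --> g1 -> g0 = g1.
Proof.
have pt (h : Cr_space r X E) : g @ G --> h -> forall x, (fun t => g t x) @ G --> h x.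
  move=> /cvg_CrP[gh _] x.
  have /cvg_comp : (fun t => (t, x)) @ G --> filter_prod G (within [set x] (nbhs x)).
    apply: cvg_filter_prod; first exact: cvg_id.
    apply: cvg_to_within; first exact: filterE.
    exact: cvg_cst.
  by move=> /(_ _ _ _ (gh [set x] (fun=> @compact_set1 _ x) (@subsetT _ _) x erefl)).
move=> /pt g0P /pt g1P; apply: Cr_space_ext => x.
exact: lcvg_unique (g0P x) (g1P x).
Qed.

(** Totalised, with junk value 0, so that the superposition operators of all d2 j f can be
named before they are known to take values in C^r(X, F). *)
Definition mkCr E (h : X -> E) : Cr_space r X E :=
  if pselect (is_Cr_map r X h) is left H then MkCr (mem_set H : h \in @Cr_pred R r M X E) else 0.

Lemma mkCrE E (h : X -> E) x : is_Cr_map r X h -> mkCr h x = h x.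
Proof. by rewrite /mkCr; case: pselect. Qed.

Section Step.
Context {F : lcsType R} {E S : preTopologicalLmodType R} {lE : lctvs E}.
Variable ev : S -> X -> E.
Hypothesis ev_Cr : forall s, is_Cr_map r X (ev s).
Hypothesis ev_lin : forall s h t x, ev (s + t *: h) x = ev s x + t *: ev h x.
Hypothesis ev_conv : forall s, Cr_conv r true (nbhs s) ev (ev s).

(** In the application S is the power C^r(X, E)^(2^j), the space called E here is
E^(2^j), and ev evaluates tuples of maps. *)
Definition superpose (f : X * E -> F) (s : S) : Cr_space r X F := mkCr (fun x => f (x, ev s x)).

Lemma superposeE (f : X * E -> F) s x : is_Cr_map r (prod_charted X E) f ->
  superpose f s x = f (x, ev s x).
Proof. by move=> cf; rewrite mkCrE//; exact: Cr_map_graph cf (ev_Cr s). Qed.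

Lemma superpose_continuous (f : X * E -> F) : is_Cr_map r (prod_charted X E) f ->
  continuous (superpose f).
Proof.
move=> cf s; apply/cvg_CrP.
have fE t : (superpose f t : X -> F) = fun x => f (x, ev t x).
  by apply/funext => x; rewrite superposeE.
have -> : (fun t => superpose f t : X -> F) = fun t x => f (x, ev t x) by apply/funext.
rewrite (fE s); exact: (Cr_conv_graph aX cf ev_Cr (ev_Cr s) (ev_conv s)).
Qed.

Definition pair_eval (p : S * S) (x : X) : (E * E)%type := (ev p.1 x, ev p.2 x).

Lemma superpose_diffq (f0 : X * E -> F) (f1 : X * (E * E)%type -> F) s h :
  (forall x, deriv_on setT (fun y => f0 (x, y)) (fun p => f1 (x, p))) ->
  is_Cr_map r (prod_charted X E) f0 -> is_Cr_map r (prod_charted X (E * E)%type) f1 ->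
  diffq (superpose f0) s h @ (0 : R)^' --> mkCr (fun x => f1 (x, pair_eval (s, h) x)).
Proof.
move=> df cf0 cf1.
have cf1s : is_Cr_map r X (fun x => f1 (x, pair_eval (s, h) x)).
  by apply: Cr_map_graph cf1 _ => //; exact: Cr_map_pair.
apply/cvg_CrP.
have -> : (mkCr (fun x => f1 (x, pair_eval (s, h) x)) : X -> F) = fun x => f1 (x, (ev s x, ev h x)).
  by apply/funext => x; rewrite mkCrE.
have -> : (fun t => diffq (superpose f0) s h t : X -> F) =
    fun t x => t^-1 *: (f0 (x, ev s x + t *: ev h x) - f0 (x, ev s x)).
  apply/funext => t; apply/funext => x.
  have -> : (diffq (superpose f0) s h t : X -> F) x =
    t^-1 *: (superpose f0 (s + t *: h) x - superpose f0 s x) by [].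
  by rewrite !superposeE// ev_lin.
by apply: Cr_conv_weak; exact: Cr_conv_quot.
Qed.

End Step.

Section Iterate.
Variable E : lcsType R.
Notation CS := (Cr_space r X E).

(** A tuple of maps as a map with values in tuples. *)
Fixpoint pow2_eval j : pow2 j CS -> X -> pow2 j E :=
  if j is m.+1 return pow2 j CS -> X -> pow2 j E
  then fun s x => (@pow2_eval m s.1 x, @pow2_eval m s.2 x) else fun s => s.

Lemma pow2_eval_Cr j s : is_Cr_map r X (pow2_eval (j := j) s).
Proof.
elim: j s => [|j IHj] s /=; first exact: Cr_spaceP.
by apply: Cr_map_pair; exact: IHj.
Qed.

Lemma pow2_eval_lin j (s h : pow2 j CS) t x : pow2_eval (s + t *: h) x = pow2_eval s x + t *: pow2_eval h x.
Proof. by elim: j s h => [//|j IHj] [s1 s2] [h1 h2] /=; rewrite !IHj. Qed.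

Lemma pow2_eval_conv j (s : pow2 j CS) : Cr_conv r true (nbhs s) (pow2_eval (j := j)) (pow2_eval s).
Proof.
elim: j s => [|j IHj] s /=.
  by apply/cvg_CrP; exact: cvg_id.
apply: (Cr_conv_pair (g := fun s : pow2 j.+1 CS => pow2_eval s.1) (h := fun s : pow2 j.+1 CS => pow2_eval s.2)).
- by move=> t; exact: pow2_eval_Cr.
- exact: pow2_eval_Cr.
- by move=> t; exact: pow2_eval_Cr.
- exact: pow2_eval_Cr.
- by apply: Cr_conv_reparam (IHj s.1); exact: cvg_fst.
- by apply: Cr_conv_reparam (IHj s.2); exact: cvg_snd.
Qed.

Variables (F : lcsType R) (k : natinf) (f : X * E -> F).
Hypothesis f_Ck : forall x, is_Ck k setT (fun y => f (x, y)).
Hypothesis d2f_Cr : forall j, le_natinf j k ->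
  is_Cr_map r (prod_charted X (pow2 j E)) (d2 j f).

Let superpos j : pow2 j CS -> Cr_space r X F := superpose (pow2_eval (j := j)) (d2 j f).

Lemma pow2_domT (Z : preTopologicalLmodType R) j : pow2_dom j [set: Z] = setT.
Proof. by elim: j => //= j ->; rewrite setXTT. Qed.

Lemma d2_deriv_on j x : le_natinf j.+1 k ->
  deriv_on setT (fun y => d2 j f (x, y)) (fun p => d2 j.+1 f (x, p)).
Proof.
move=> jk; have [_] := f_Ck x jk; rewrite pow2_domT.
by move=> /is_C1_deriv_on-/(_ openT)[].
Qed.

Lemma superpos_diffq j s h : le_natinf j.+1 k ->
  diffq (superpos (j := j)) s h @ (0 : R)^' --> superpos (j := j.+1) (s, h).
Proof.
move=> jk; have jk' : le_natinf j k by exact: le_natinf_trans jk.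
apply: (@superpose_diffq F (pow2 j E) (pow2 j CS) _ (pow2_eval (j := j))).
- exact: pow2_eval_Cr.
- exact: pow2_eval_lin.
- by move=> x; exact: d2_deriv_on.
- exact: d2f_Cr.
- exact: (d2f_Cr jk).
Qed.

(** Uniqueness of limits in C^r(X, F) turns [superpos_diffq] into an
equality for [dd], hence by induction for [dn]. *)
Lemma dn_superpos j : le_natinf j k -> dn j (superpos (j := 0)) = superpos (j := j).
Proof.
elim: j => [//|j IHj] jk /=; rewrite IHj; last exact: le_natinf_trans jk.
apply/funext => -[s h]; apply: xget_unique => /=; first exact: superpos_diffq.
by move=> l; move=> sl; apply: (Cr_cvg_unique sl); exact: superpos_diffq.
Qed.

Lemma superpos_continuous j : le_natinf j k -> continuous (superpos (j := j)).
Proof.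
by move=> jk; apply: superpose_continuous; [exact: pow2_eval_Cr|exact: pow2_eval_conv|exact: d2f_Cr].
Qed.

Lemma superpos_C1 j : le_natinf j.+1 k -> is_C1 setT (dn j (superpos (j := 0))).
Proof.
move=> jk; have jk' : le_natinf j k by exact: le_natinf_trans jk.
split.
- by rewrite dn_superpos//; apply: continuous_subspaceT; exact: superpos_continuous.
- by move=> s h _; rewrite dn_superpos//; exists (superpos (j := j.+1) (s, h)); exact: superpos_diffq.
- have -> : dd (dn j (superpos (j := 0))) = superpos (j := j.+1) by exact: (dn_superpos jk).
  by apply: continuous_subspaceT; exact: (superpos_continuous (j := j.+1) jk).
Qed.

Lemma superpos_Ck : is_Ck k setT (superpos (j := 0)).
Proof.
elim=> [k0|n IHn nk] /=.
  by apply: continuous_subspaceT; exact: (superpos_continuous (j := 0) k0).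
split; first by apply: IHn; exact: le_natinf_trans nk.
by rewrite pow2_domT; exact: superpos_C1.
Qed.

Lemma superpos0E (g : CS) x : superpos (j := 0) g x = f (x, g x).
Proof.
have k0 : le_natinf 0 k by case: k.
by rewrite /superpos superposeE//; [exact: pow2_eval_Cr|exact: (d2f_Cr k0)].
Qed.

End Iterate.
End CrSpace.

Theorem proposition2p5 (R : realType) (r k : natinf) (M E F : lcs R)
  (X : chartedSpace M) (hausX : hausdorff_space X)
  (atlasX : le_natinf 1 r -> is_atlas r X)
  (K : set X) (compK : compact K)
  (f : X * E -> F)
  (f_partially_Ck : partially_Ck k f)
  (d2f_Cr : forall j : nat, le_natinf j k ->
    is_Cr_map r (prod_charted X (pow2 j E)) (d2 j f)) :
  exists f_star : Cr_space r X E -> Cr_space r X F,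
    (forall (g : Cr_space r X E) (x : X), f_star g x = f (x, g x)) /\
    is_Ck k [set: Cr_space r X E] f_star.
Proof.
exists (superpose (pow2_eval (j := 0)) (d2 0 f)); split.
  by move=> g x; exact: (superpos0E atlasX d2f_Cr).
by apply: (superpos_Ck hausX atlasX _ d2f_Cr) => x; exact: f_partially_Ck.1.
Qed.
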